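(* Let $\varphi:[0,\infty)\to\mathrm{SL}(n,\mathbb R)$ be a continuous curve definable in an o-minimal structure. Then $\varphi$ is non-contracting (for $\mathrm{SL}(n,\mathbb R)$) if and only if for all $1\le k\le n-1$ and all linearly independent vectors $v_1,\dots,v_k\in\mathbb R^n$, $$\lim_{t\to\infty}\varphi(t)\cdot(v_1\wedge\cdots\wedge v_k)\neq0 .$$
   Context: An o-minimal structure means an o-minimal structure on the ordered field of real numbers. A curve $\varphi:[0,\infty)\to \mathrm{SL}(n,\mathbb R)$ is definable if all its matrix entries are definable functions. A definable curve $\varphi$ in the real points $G$ of an affine algebraic group over $\mathbb R$ is non-contracting for $G$ if for every finite-dimensional rational representation $V$ of $G$ defined over $\mathbb R$ and every $v\in V\setminus\{0\}$, $\lim_{t\to\infty}\varphi(t)\cdot v\neq0$ (by o-minimality the limit exists in $V\cup\{\infty\}$). The group $\mathrm{SL}(n,\mathbb R)$ acts on $\bigwedge^k\mathbb R^n$ by $g\cdot(v_1\wedge\cdots\wedge v_k)=gv_1\wedge\cdots\wedge gv_k$. *)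

(* Defs.v *)
From mathcomp Require Import all_boot all_order all_fingroup all_algebra.
From mathcomp Require mpoly.
From mathcomp Require Import all_classical all_reals all_analysis.
Import Order.TTheory GRing.Theory Num.Theory.
Import numFieldNormedType.Exports.

Set Implicit Arguments.
Unset Strict Implicit.
Unset Printing Implicit Defensive.

Local Open Scope classical_set_scope.
Local Open Scope ring_scope.

(* O-minimal structures on the ordered field of real numbers, in the sense of
   van den Dries and Miller; [interval R] includes the empty, degenerate and
   unbounded intervals, so all real constants are definable. *)
Record omin_structure (R : realType) := OminStructure {
  definable : forall m, set (set 'rV[R]_m);
  definableT : forall m, definable [set: 'rV[R]_m];
  definableC : forall m (A : set 'rV[R]_m), definable A -> definable (~` A);
  definableU : forall m (A B : set 'rV[R]_m),
    definable A -> definable B -> definable (A `|` B);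
  definable_diag : forall m (i j : 'I_m),
    definable [set x : 'rV[R]_m | x 0 i = x 0 j];
  definable_prodr : forall m (A : set 'rV[R]_m),
    definable A -> definable [set x : 'rV[R]_(m + 1) | A (lsubmx x)];
  definable_prodl : forall m (A : set 'rV[R]_m),
    definable A -> definable [set x : 'rV[R]_(1 + m) | A (rsubmx x)];
  definable_proj : forall m (A : set 'rV[R]_(m + 1)),
    definable A -> definable [set lsubmx x | x in A];
  definable_lt : definable [set x : 'rV[R]_2 | x 0 0 < x 0 1];
  definable_add : definable [set x : 'rV[R]_3 | x 0 ord_max = x 0 0 + x 0 1];
  definable_mul : definable [set x : 'rV[R]_3 | x 0 ord_max = x 0 0 * x 0 1];
  definable_omin : forall A : set 'rV[R]_1, definable A <->
    exists s : seq (interval R), A = [set x | exists2 I, I \in s & x 0 0 \in I]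
}.

Definition definable_fun (R : realType) (S : omin_structure R)
    (D : set R) (f : R -> R) : Prop :=
  definable S [set x : 'rV[R]_2 | D (x 0 0) /\ x 0 1 = f (x 0 0)].

Definition SL {R : realType} {n : nat} : set 'M[R]_n := [set g | \det g = 1].

(* A representation of SL(n, R) on the column space R^d; only the values of
   [rho] on SL(n, R) matter. The coordinate ring of SL_n is
   R[x_ij]/(det - 1), so regular functions are polynomials in the entries. *)
Definition rational_repr (R : realType) (n d : nat)
    (rho : 'M[R]_n -> 'M[R]_d) : Prop :=
  [/\ rho 1%:M = 1%:M,
      forall g h, SL g -> SL h -> rho (g *m h) = rho g *m rho h &
      forall i j, exists p : mpoly.mpoly (n * n) R,
        forall g, SL g -> rho g i j = mpoly.meval (mxvec g 0) p].

(* Limits are taken in V u {oo}: a limit is nonzero when the curve does not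
   converge to 0. *)
Definition non_contracting (R : realType) (n : nat) (phi : R -> 'M[R]_n) :
    Prop :=
  forall (d : nat) (rho : 'M[R]_n -> 'M[R]_d), rational_repr rho ->
  forall v : 'cV[R]_d, v != 0 -> ~ (rho (phi t) *m v @[t --> +oo] --> (0 : 'cV[R]_d)).

(* Multi-indices i_1 < ... < i_k, for the basis e_I = e_{i_1} /\ ... /\ e_{i_k}
   of the k-th exterior power of R^n. *)
Definition incr_tuples (k n : nat) : {set k.-tuple 'I_n} :=
  [set I : k.-tuple 'I_n | sorted ltn (map val I)].

Definition extdim (k n : nat) : nat := #|incr_tuples k n|.

Definition wedge (R : realType) (k n : nat) (v : k.-tuple 'cV[R]_n) :
    'cV[R]_(extdim k n) :=
  \col_a \det (\matrix_(i, j) tnth v j (tnth (enum_val a) i) 0).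

(* g e_J = sum_I det(g_{I,J}) e_I; see [extmx_wedge]. *)
Definition extmx (R : realType) (k n : nat) (g : 'M[R]_n) :
    'M[R]_(extdim k n) :=
  \matrix_(a, b) \det (mxsub (tnth (enum_val a)) (tnth (enum_val b)) g).

Lemma extdimE k n : extdim k n = 'C(n, k).
Proof. exact: card_ltn_sorted_tuples. Qed.

Lemma det_mulmx_ffun (R : comNzRingType) (k n : nat)
    (X : 'M[R]_(k, n)) (Y : 'M[R]_(n, k)) :
  \det (X *m Y) =
  \sum_(f : {ffun 'I_k -> 'I_n}) (\prod_i X i (f i)) * \det (rowsub f Y).
Proof.
rewrite /determinant.
under eq_bigr => s _.
  under eq_bigr => i _ do rewrite mxE.
  rewrite bigA_distr_bigA /= mulr_sumr.
  over.
rewrite exchange_big /=; apply: eq_bigr => f _.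
rewrite mulr_sumr; apply: eq_bigr => s _.
rewrite big_split /= mulrCA; congr (_ * (_ * _)).
by apply: eq_bigr => i _; rewrite mxE.
Qed.

Lemma cauchy_binet (R : comNzRingType) (k n : nat)
    (X : 'M[R]_(k, n)) (Y : 'M[R]_(n, k)) :
  \det (X *m Y) = \sum_(I in incr_tuples k n)
    \det (colsub (tnth I) X) * \det (rowsub (tnth I) Y).
Proof.
rewrite det_mulmx_ffun.
rewrite (bigID (fun f : {ffun 'I_k -> 'I_n} => injectiveb f)) /= addrC big1 ?add0r; last first.
  move=> f /injectivePn [i [j ij fij]].
  by rewrite (determinant_alternate ij) ?mulr0// => l; rewrite !mxE fij.
pose leI := relpre (val : 'I_n -> nat) leq.
pose p (f : {ffun 'I_k -> 'I_n}) : k.-tuple 'I_n :=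
  [tuple of sort leI [tuple f i | i < k]].
have leI_total : total leI by move=> i j; exact: leq_total.
have leI_trans : transitive leI by move=> i j l; exact: leq_trans.
have leI_anti : antisymmetric leI.
  by move=> i j ij; apply/val_inj/anti_leq.
have incrE (I : k.-tuple 'I_n) : I \in incr_tuples k n = uniq I && sorted leI I.
  by rewrite inE ltn_sorted_uniq_leq map_inj_uniq ?sorted_map//; exact: val_inj.
rewrite (partition_big p (mem (incr_tuples k n))) /=; last first.
  move=> f /injectiveP fi; rewrite incrE /= sort_uniq sort_sorted // andbT.
  by rewrite map_inj_uniq // enum_uniq.
apply: eq_bigr => I; rewrite incrE => /andP[Iu Is].
have Ii : injective (tnth I) by apply/tuple_uniqP.
pose h (s : 'S_k) : {ffun 'I_k -> 'I_n} := [ffun i => tnth I (s i)].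
have hi : injective h.
  by move=> s t /ffunP st; apply/permP => i; have := st i; rewrite !ffunE => /Ii.
rewrite (eq_bigl (mem (imset h (mem {: 'S_k})))); last first.
  move=> f /=; apply/idP/imsetP.
    move=> /andP[fi /eqP pf].
    have /tuple_permP[s sE] : perm_eq [tuple f i | i < k] I.
      by rewrite -pf perm_sym /= perm_sort.
    exists s => //; apply/ffunP => i; rewrite ffunE.
    have /val_inj /(congr1 (fun t => tnth t i)) := sE.
    by rewrite !tnth_mktuple.
  move=> [s _ ->]; apply/andP; split.
    by apply/injectiveP => i j; rewrite !ffunE => /Ii /perm_inj.
  apply/eqP/val_inj; apply: (sorted_eq leI_trans leI_anti) => //=.
    exact: sort_sorted.
  rewrite perm_sort; apply/tuple_permP; exists s.
  by rewrite /=; apply: eq_map => i; rewrite ffunE.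
rewrite big_imset /=; last by move=> s t _ _; exact: hi.
rewrite [in RHS]/determinant mulr_suml; apply: eq_big => [s|s _]; first by rewrite inE.
have -> : rowsub (h s) Y = row_perm s (rowsub (tnth I) Y).
  by apply/matrixP => i j; rewrite !mxE ffunE.
rewrite row_permE det_mulmx det_perm mulrCA mulrA; congr (_ * _ * _).
by apply: eq_bigr => i _; rewrite !mxE ffunE.
Qed.

Lemma extmx_wedge (R : realType) (k n : nat) (g : 'M[R]_n)
    (v : k.-tuple 'cV[R]_n) :
  extmx k g *m wedge v = wedge [tuple g *m tnth v j | j < k].
Proof.
apply/colP => a; rewrite !mxE.
pose Y : 'M[R]_(n, k) := \matrix_(i, j) tnth v j i 0.
transitivity (\det (rowsub (tnth (enum_val a)) g *m Y)); last first.
  congr (\det _); apply/matrixP => i j; rewrite !mxE tnth_mktuple !mxE.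
  by apply: eq_bigr => l _; rewrite !mxE.
rewrite cauchy_binet [RHS]big_enum_val /=.
apply: eq_bigr => b _; rewrite !mxE; congr (_ * _); congr determinant.
  by apply/matrixP => i j; rewrite !mxE.
by apply/matrixP => i j; rewrite !mxE.
Qed.

(* Main.v *)
(* If [rho (phi t) *m v] tends to 0, Kempf's optimal destabilising flag of [v]
   is contracted by [phi]. By the Cartan decomposition some [k] in SO(n) and
   some real weight vector [theta] give all weights [w] of [rho k *m v] the bound
   [<w, theta> <= -1]; take [lam], in a rotated basis, of least norm among such
   [theta]. Let [x] be the part of [v] where [<w, lam> = -1]. Write [phi = k p]
   with [p] triangular for the order of the entries of [lam]; the block diagonal
   part [p0] of [p] satisfies [rho p0 x = (rho p v)_(-1)], which tends to 0. If
   the Pluecker vectors of the flag of [lam] stay away from 0 along [phi], then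
   [exp s * rho p0 x] tends to 0 too, where [s |lam|^2 = sum_i lam_i ln p_ii],
   and the Cartan decomposition of [p0] yields a direction orthogonal to [lam]
   along which [lam] can be improved, a contradiction. O-minimality turns
   "does not tend to 0" into "stays away from 0". Limits along [t] are taken
   along an ultrafilter, so that bounded functions converge. *)

Require Import Defs.
From mathcomp Require Import all_boot all_order all_fingroup all_algebra.
From mathcomp Require Import ring lra.
From mathcomp Require Import all_classical all_reals all_analysis.
From mathcomp Require mpoly.
Import Order.TTheory GRing.Theory Num.Theory.
Import numFieldNormedType.Exports.

Set Implicit Arguments.
Unset Strict Implicit.
Unset Printing Implicit Defensive.

Local Open Scope classical_set_scope.
Local Open Scope ring_scope.

(** * Limits of matrices *)

(** The delicate point is the factor [exp s]. The Pluecker norms of the flag along [phi] are the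
    products of the first diagonal entries of [p], taken in the order of [lam]. Bounding them below
    bounds the partial sums of the [ln p_ii] below; the total sum is 0, so summation by parts
    against the increasing entries of [lam] bounds [s] above, and [exp s] cannot spoil the
    convergence to 0. The value of [s] is forced. If [p0 = k1 exp(eta) k2], comparing determinants
    block by block gives [<lam, eta> = s |lam|^2], so [zeta = eta - s lam] is orthogonal to [lam].
    On the weights with [<w, lam> = -1] one has [<w, zeta> = <w, eta> + s], which the convergence
    makes negative. Passing from [lam] to [lam + x zeta] changes the squared norm by a term in [x^2]
    only, but lowers the extremal weights linearly in [x]; rescaling then gives a shorter vector.
    Frames range over a compact group and weight vectors are real, so the least norm is attained.
    The other direction of the theorem is that exterior powers are rational representations and
    independent vectors have nonzero wedge. *)

Lemma cvg_mxP (R : realType) (T : Type) (F : set_system T) {FF : Filter F}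
    (m n : nat) (f : T -> 'M[R]_(m, n)) (l : 'M[R]_(m, n)) :
  f @ F --> l <-> forall i j, f t i j @[t --> F] --> l i j.
Proof.
split=> [fl i j A lA | fl A [P lP sPA]].
  have := fl [set M | A (M i j)]; apply.
  exists (fun i' j' => [set x | i' = i -> j' = j -> A x]).
    move=> i' j'; have [->|/eqP ni] := eqVneq i' i; last first.
      by apply: filterS filterT => x _ /ni.
    have [->|/eqP nj] := eqVneq j' j; last first.
      by apply: filterS filterT => x _ _ /nj.
    by apply: filterS lA => x Ax.
  by move=> M /(_ i j); apply.
have : \forall t \near F, forall ij : 'I_m * 'I_n, P ij.1 ij.2 (f t ij.1 ij.2).
  by apply: filter_forall => ij; exact: (fl ij.1 ij.2).
by apply: filterS => t Pt; apply: sPA => i j; exact: (Pt (i, j)).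
Qed.

Lemma cvg_prod_seq (R : realType) (T I : Type) (F : set_system T)
    {FF : Filter F} (s : seq I) (P : pred I) (f : I -> T -> R) (l : I -> R) :
  (forall i, f i @ F --> l i) ->
  \prod_(i <- s | P i) f i t @[t --> F] --> \prod_(i <- s | P i) l i.
Proof.
move=> fl; elim: s => [|i s IH].
  by under eq_fun do rewrite big_nil; rewrite big_nil; exact: cvg_cst.
under eq_fun do rewrite big_cons; rewrite big_cons; case: (P i) => //.
exact: cvgM (fl i) IH.
Qed.

Lemma cvg_sum_seq (R : realType) (T I : Type) (F : set_system T)
    {FF : Filter F} (s : seq I) (P : pred I) (f : I -> T -> R) (l : I -> R) :
  (forall i, f i @ F --> l i) ->
  \sum_(i <- s | P i) f i t @[t --> F] --> \sum_(i <- s | P i) l i.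
Proof.
move=> fl; elim: s => [|i s IH].
  by under eq_fun do rewrite big_nil; rewrite big_nil; exact: cvg_cst.
under eq_fun do rewrite big_cons; rewrite big_cons; case: (P i) => //.
exact: cvgD (fl i) IH.
Qed.

Lemma cvg_mulmx (R : realType) (T : Type) (F : set_system T) {FF : Filter F}
    (m n p : nat) (f : T -> 'M[R]_(m, n)) (g : T -> 'M[R]_(n, p))
    (a : 'M[R]_(m, n)) (b : 'M[R]_(n, p)) :
  f @ F --> a -> g @ F --> b -> f t *m g t @[t --> F] --> a *m b.
Proof.
move=> /cvg_mxP fa /cvg_mxP gb; apply/cvg_mxP => i j; rewrite mxE.
under eq_fun do rewrite mxE.
by apply: cvg_sum_seq => k; apply: cvgM; [exact: fa | exact: gb].
Qed.

Lemma cvg_trmx (R : realType) (T : Type) (F : set_system T) {FF : Filter F}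
    (m n : nat) (f : T -> 'M[R]_(m, n)) (a : 'M[R]_(m, n)) :
  f @ F --> a -> (f t)^T @[t --> F] --> a^T.
Proof.
move=> /cvg_mxP fa; apply/cvg_mxP => i j; rewrite mxE.
by under eq_fun do rewrite mxE; exact: fa.
Qed.

Lemma cvg_scalemx (R : realType) (T : Type) (F : set_system T) {FF : Filter F}
    (m n : nat) (c : T -> R) (f : T -> 'M[R]_(m, n)) (x : R)
    (a : 'M[R]_(m, n)) :
  c @ F --> x -> f @ F --> a -> c t *: f t @[t --> F] --> x *: a.
Proof.
move=> cx /cvg_mxP fa; apply/cvg_mxP => i j; rewrite mxE.
by under eq_fun do rewrite mxE; apply: cvgM => //; exact: fa.
Qed.

Lemma cvg_det (R : realType) (T : Type) (F : set_system T) {FF : Filter F}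
    (n : nat) (f : T -> 'M[R]_n) (a : 'M[R]_n) :
  f @ F --> a -> \det (f t) @[t --> F] --> \det a.
Proof.
move=> /cvg_mxP fa; apply: cvg_sum_seq => s; apply: cvgM; first exact: cvg_cst.
by apply: cvg_prod_seq => i; exact: fa.
Qed.

Lemma cvg_mx_unique (R : realType) (T : Type) (F : set_system T)
    {FF : ProperFilter F} (m n : nat) (f : T -> 'M[R]_(m, n))
    (a b : 'M[R]_(m, n)) :
  f @ F --> a -> f @ F --> b -> a = b.
Proof.
move=> /cvg_mxP fa /cvg_mxP fb; apply/matrixP => i j.
exact: (cvg_unique (@Rhausdorff R) (fa i j) (fb i j)).
Qed.

Lemma cvg_near_eq (R : realType) (T : Type) (F : set_system T)
    {FF : Filter F} (f g : T -> R) (l : R) :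
  (\forall t \near F, f t = g t) -> f @ F --> l -> g @ F --> l.
Proof. by move=> fg; apply: cvg_trans; exact: near_eq_cvg. Qed.

Lemma cvg_mx_near_eq (R : realType) (T : Type) (F : set_system T)
    {FF : Filter F} (m n : nat) (f g : T -> 'M[R]_(m, n)) (l : 'M[R]_(m, n)) :
  (\forall t \near F, f t = g t) -> f @ F --> l -> g @ F --> l.
Proof. by move=> fg; apply: cvg_trans; exact: near_eq_cvg. Qed.

Lemma fmap_ultra (T U : Type) (f : T -> U) (F : set_system T) :
  UltraFilter F -> UltraFilter (f @ F).
Proof.
move=> FU; split=> [|G GF sFG]; first exact: fmap_proper_filter.
rewrite predeqE => A; split=> [GA|]; last exact: sFG.
have [//|FA] := in_ultra_setVsetC (f @^-1` A) FU.
have /filter_ex [x []] // : G (A `&` ~` A).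
by apply: filterI => //; exact: sFG.
Qed.

Lemma ultra_bounded_cvg (R : realType) (T : Type) (F : set_system T)
    {FU : UltraFilter F} (f : T -> R) (B : R) :
  (\forall t \near F, `|f t| <= B) -> exists l : R, f @ F --> l.
Proof.
move=> fB; have := @segment_compact R (- B) B; rewrite compact_ultra.
move=> /(_ (f @ F) (fmap_ultra f FU)) [|l [_ fl]]; last by exists l.
by apply: filterS fB => t /=; rewrite in_itv /= ler_norml.
Qed.

Lemma ultra_bounded_cvg_mx (R : realType) (T : Type) (F : set_system T)
    {FU : UltraFilter F} (m n : nat) (f : T -> 'M[R]_(m, n)) (B : R) :
  (\forall t \near F, forall i j, `|f t i j| <= B) ->
  exists l : 'M[R]_(m, n), f @ F --> l.
Proof.
move=> fB.
have [l fl] := choice (fun ij : 'I_m * 'I_n =>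
  ultra_bounded_cvg (filterS (fun t fBt => fBt ij.1 ij.2) fB)).
exists (\matrix_(i, j) l (i, j)); apply/cvg_mxP => i j; rewrite mxE.
exact: (fl (i, j)).
Qed.

(** A maximising sequence, with an ultrafilter finer than [\oo]: all bounded data attached to the
    sequence then converge along it simultaneously, which takes the place of extracting
    subsequences. *)
Lemma ultra_sup (R : realType) (E : set R) : has_sup E ->
  exists (F : set_system nat) (e : nat -> R),
    [/\ UltraFilter F, forall k, E (e k) & e @ F --> sup E].
Proof.
move=> supE.
have /choice [e eE] (k : nat) : exists x, E x /\ sup E - k.+1%:R^-1 < x.
  have k0 : 0 < k.+1%:R^-1 :> R by rewrite invr_gt0.
  by have [x Ex xE] := sup_adherent k0 supE; exists x.
have [F [FU sF]] := @ultraFilterLemma nat \oo _.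
exists F, e; split=> [//|k|]; first by have [] := eE k.
apply: (@cvg_trans _ (e @ \oo)); first by move=> A /sF.
apply: (@squeeze_cvgr _ _ _ _ (fun k => sup E - k.+1%:R^-1) (cst (sup E))).
- near=> k; have [Ek /ltW ->] := eE k => /=.
  by apply: ub_le_sup => //; case: supE.
- rewrite -[X in _ --> X]subr0; apply: cvgB; first exact: cvg_cst.
  exact: cvg_harmonic.
- exact: cvg_cst.
Unshelve. all: by end_near. Qed.

(** * Cartan decomposition *)

Definition orthogonalmx (R : realType) (n : nat) : set 'M[R]_n :=
  [set k | k^T *m k = 1%:M].

(* The matrices commuting with [diag_mx lam]. *)
Definition levi (R : realType) (n : nat) (lam : 'rV[R]_n) : set 'M[R]_n :=
  [set g | forall i j, lam 0 i != lam 0 j -> g i j = 0].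

Definition expmx (R : realType) (n : nat) (eta : 'rV[R]_n) : 'M[R]_n :=
  diag_mx (map_mx expR eta).

Section Orthogonal.
Variables (R : realType) (n : nat).
Implicit Types (g k : 'M[R]_n) (lam eta : 'rV[R]_n).

Lemma orthogonalmx1 : orthogonalmx (1%:M : 'M[R]_n).
Proof. by rewrite /orthogonalmx /= trmx1 mulmx1. Qed.

Lemma orthogonalmx_mulr k : orthogonalmx k -> k *m k^T = 1%:M.
Proof. by move=> /mulmx1C. Qed.

Lemma orthogonalmxM k1 k2 : orthogonalmx k1 -> orthogonalmx k2 -> orthogonalmx (k1 *m k2).
Proof.
by rewrite /orthogonalmx /= => k1o k2o; rewrite trmx_mul mulmxA -[_ *m k1]mulmxA k1o mulmx1.
Qed.

Lemma orthogonalmxT k : orthogonalmx k -> orthogonalmx k^T.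
Proof. by move=> /orthogonalmx_mulr; rewrite /orthogonalmx /= trmxK. Qed.

Lemma orthogonalmx_entry k i j : orthogonalmx k -> `|k i j| <= 1.
Proof.
move=> /(congr1 (fun M : 'M[R]_n => M j j)); rewrite !mxE eqxx mulr1n.
rewrite (bigD1 i) //= mxE => kE.
have h : 0 <= \sum_(l < n | l != i) k^T j l * k l j.
  by apply: sumr_ge0 => l _; rewrite mxE -expr2 sqr_ge0.
have : k i j ^+ 2 <= 1 by rewrite -kE expr2 lerDl.
by rewrite -real_normK ?num_real // expr_le1.
Qed.

Lemma orthogonalmx_det k : orthogonalmx k -> (\det k == 1) || (\det k == -1).
Proof.
move=> /(congr1 determinant); rewrite det_mulmx det_tr det1 -expr2 => /eqP.
by rewrite sqrf_eq1.
Qed.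

Lemma orthogonalmx_cvg (T : Type) (F : set_system T) {FF : ProperFilter F}
    (f : T -> 'M[R]_n) (k : 'M[R]_n) :
  (\forall t \near F, orthogonalmx (f t)) -> f @ F --> k -> orthogonalmx k.
Proof.
move=> fo fk; apply: (cvg_mx_unique (cvg_mulmx (cvg_trmx fk) fk)).
apply: (cvg_mx_near_eq (f := cst 1%:M)); last exact: cvg_cst.
by apply: filterS fo => t /= ->.
Qed.

Lemma levi1 lam : levi lam 1%:M.
Proof.
by move=> i j ij; rewrite mxE; case: (eqVneq i j) ij => [->|//]; rewrite eqxx.
Qed.

Lemma leviM lam g k : levi lam g -> levi lam k -> levi lam (g *m k).
Proof.
move=> gl kl i j ij; rewrite mxE big1 // => l _.
have [il|il] := eqVneq (lam 0 i) (lam 0 l); last by rewrite gl ?mul0r.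
by rewrite kl ?mulr0 // -il.
Qed.

Lemma leviT lam g : levi lam g -> levi lam g^T.
Proof. by move=> gl i j ij; rewrite mxE gl // eq_sym. Qed.

Lemma levi_diag lam (d : 'rV[R]_n) : levi lam (diag_mx d).
Proof.
by move=> i j ij; rewrite mxE; case: (eqVneq i j) ij => [->|//]; rewrite eqxx.
Qed.

Lemma levi_cvg lam (T : Type) (F : set_system T) {FF : ProperFilter F}
    (f : T -> 'M[R]_n) (k : 'M[R]_n) :
  (\forall t \near F, levi lam (f t)) -> f @ F --> k -> levi lam k.
Proof.
move=> fl /cvg_mxP fk i j ij.
apply: (cvg_unique (@Rhausdorff R) (fk i j)).
apply: (cvg_near_eq (f := cst 0)); last exact: cvg_cst.
by apply: filterS fl => t ->.
Qed.

Lemma det_expmx eta : \det (expmx eta) = expR (\sum_i eta 0 i).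
Proof.
by rewrite det_diag expR_sum; apply: eq_bigr => i _; rewrite mxE.
Qed.

Lemma expmxD eta lam : expmx (eta + lam) = expmx eta *m expmx lam.
Proof.
rewrite mulmx_diag; congr diag_mx.
by apply/rowP => i; rewrite !mxE expRD.
Qed.

Lemma expmx0 : expmx (0 : 'rV[R]_n) = 1%:M.
Proof.
by apply/matrixP => i j; rewrite !mxE expR0.
Qed.

Lemma SL_expmx eta : \sum_i eta 0 i = 0 -> SL (expmx eta).
Proof. by move=> eta0; rewrite /SL /= det_expmx eta0 expR0. Qed.

Lemma SLM g k : SL g -> SL k -> SL (g *m k).
Proof. by rewrite /SL /= det_mulmx => -> ->; rewrite mulr1. Qed.

Lemma SLT g : SL g -> SL g^T.
Proof. by rewrite /SL /= det_tr. Qed.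

(** Rotation in the (i, j) plane with cosine [c] and sine [s]. With [D] the projection onto the
    plane and [J] the infinitesimal rotation, products reduce to [DD = D], [DJ = JD = J] and
    [JJ = -D]. *)
Definition rotmx (i j : 'I_n) (c s : R) : 'M[R]_n :=
  1%:M + (c - 1) *: (delta_mx i i + delta_mx j j)
       + s *: (delta_mx i j - delta_mx j i).

Lemma rotmx_ortho i j c s : i != j -> c ^+ 2 + s ^+ 2 = 1 ->
  orthogonalmx (rotmx i j c s).
Proof.
move=> ij cs; rewrite /orthogonalmx /= /rotmx.
set D := delta_mx i i + delta_mx j j; set J := delta_mx i j - delta_mx j i.
have ji : j != i by rewrite eq_sym.
have DD : D *m D = D.
  by rewrite /D mulmxDl !mulmxDr !mul_delta_mx_cond !eqxx (negPf ij) (negPf ji)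
    !mulr0n !mulr1n addr0 add0r.
have DJ : D *m J = J.
  by rewrite /D /J mulmxDl !mulmxBr !mul_delta_mx_cond !eqxx (negPf ij)
    (negPf ji) !mulr0n !mulr1n subr0 sub0r.
have JD : J *m D = J.
  by rewrite /D /J mulmxBl !mulmxDr !mul_delta_mx_cond !eqxx (negPf ij)
    (negPf ji) !mulr0n !mulr1n addr0 add0r.
have JJ : J *m J = - D.
  by rewrite /D /J mulmxBl !mulmxBr !mul_delta_mx_cond !eqxx (negPf ij)
    (negPf ji) !mulr0n !mulr1n !sub0r subr0 opprD.
have -> : (1%:M + (c - 1) *: D + s *: J)^T = 1%:M + (c - 1) *: D - s *: J.
  have TD : D^T = D by rewrite /D linearD /= !trmx_delta.
  have TJ : J^T = - J by rewrite /J linearB /= !trmx_delta opprB.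
  by rewrite 2!linearD /= trmx1 2!linearZ /= TD TJ scalerN.
rewrite mulmxBl mulmxDl !mulmxDr !mul1mx !mulmx1 -!scalemxAl -!scalemxAr.
rewrite DD DJ JD JJ !scalerA.
have {}cs : c ^+ 2 = 1 - s ^+ 2 by rewrite -cs addrK.
clearbody D J; apply/matrixP => a b; rewrite !mxE.
by ring: cs.
Qed.

Lemma rotmx_levi lam i j c s : lam 0 i = lam 0 j -> levi lam (rotmx i j c s).
Proof.
move=> ij a b ab; rewrite !mxE.
have [ba|_] := eqVneq a b; first by rewrite ba eqxx in ab.
have -> : (a == i) && (b == i) = false.
  by apply/negP => /andP[/eqP ai /eqP bi]; rewrite ai bi eqxx in ab.
have -> : (a == j) && (b == j) = false.
  by apply/negP => /andP[/eqP ai /eqP bi]; rewrite ai bi eqxx in ab.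
have -> : (a == i) && (b == j) = false.
  by apply/negP => /andP[/eqP ai /eqP bi]; rewrite ai bi ij eqxx in ab.
have -> : (a == j) && (b == i) = false.
  by apply/negP => /andP[/eqP ai /eqP bi]; rewrite ai bi ij eqxx in ab.
by rewrite !mulr0n subrr addr0 !mulr0 !addr0.
Qed.

Lemma mxtrace_mul_delta (M : 'M[R]_n) i j : \tr (M *m delta_mx i j) = M j i.
Proof.
rewrite /mxtrace (bigD1 j) //= big1 => [|l lj].
  rewrite mxE (bigD1 i) //= big1 => [|l li]; rewrite mxE ?eqxx ?mulr1 ?addr0 //.
  by rewrite (negPf li) mulr0.
by rewrite mxE big1 // => k _; rewrite mxE (negPf lj) andbF mulr0.
Qed.

Lemma mxtrace_mul_rotmx (M : 'M[R]_n) i j c s :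
  \tr (M *m rotmx i j c s) =
  \tr M + (c - 1) * (M i i + M j j) + s * (M j i - M i j).
Proof.
rewrite /rotmx !mulmxDr mulmx1 -!scalemxAr mulmxDr mulmxBr.
by rewrite !mxtraceD !mxtraceZ !mxtraceD linearN /= !mxtrace_mul_delta.
Qed.
End Orthogonal.

(** A linear form on the unit circle that is maximal at (1, 0) has its gradient (a, b) along the
    first axis. Evaluating at the unit vector along (a, b) shows this without derivatives. *)
Lemma circle_max_eq0 (R : realType) (a b : R) :
  (forall c s, c ^+ 2 + s ^+ 2 = 1 -> (c - 1) * a + s * b <= 0) -> b = 0.
Proof.
move=> h; apply/eqP/negP => /negP b0.
have r0 : 0 < a ^+ 2 + b ^+ 2.
  by rewrite ltr_wpDl ?sqr_ge0 // lt_neqAle sqr_ge0 eq_sym sqrf_eq0 b0.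
set r := Num.sqrt (a ^+ 2 + b ^+ 2).
have rp : 0 < r by rewrite sqrtr_gt0.
have rE : r ^+ 2 = a ^+ 2 + b ^+ 2 by rewrite sqr_sqrtr // ltW.
have := h (a / r) (b / r); rewrite !expr_div_n -mulrDl -rE divff ?expf_neq0 ?gt_eqF //.
move=> /(_ erefl).
have -> : (a / r - 1) * a + b / r * b = (a ^+ 2 + b ^+ 2) / r - a by field; rewrite gt_eqF.
rewrite -rE expr2 mulfK ?gt_eqF // subr_le0 => ra.
have : r ^+ 2 <= a ^+ 2 by rewrite ler_pXn2r // nnegrE ?ltW // (lt_le_trans rp).
by rewrite rE gerDl leNgt lt_neqAle sqr_ge0 eq_sym sqrf_eq0 b0.
Qed.

(* First-order conditions for left and right rotations in the (i, j) plane; the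
   diagonal entries of [W] have distinct squares. *)
Lemma maximizer_diagonal (R : realType) (n : nat) (lam : 'rV[R]_n)
    (h : 'M[R]_n) (W := diag_mx (\row_i (i.+1%:R : R))) :
  levi lam h ->
  (forall k, orthogonalmx k -> levi lam k ->
    \tr (W *m k *m h) <= \tr (W *m h) /\ \tr (W *m h *m k) <= \tr (W *m h)) ->
  forall i j, i != j -> h i j = 0.
Proof.
move=> hl hmax i j ij.
have [lij|] := eqVneq (lam 0 i) (lam 0 j); last exact: hl.
have WhE (a b : 'I_n) : (W *m h) a b = a.+1%:R * h a b.
  by rewrite mul_diag_mx !mxE.
have hWE (a b : 'I_n) : (h *m W) a b = h a b * b.+1%:R.
  by rewrite mul_mx_diag !mxE.
(* By cyclicity the trace of [W k h] is that of [h W k], so left rotations make [h W] symmetric at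
   (i, j); right rotations do the same for [W h]. *)
have e1 : (h *m W) j i - (h *m W) i j = 0.
  apply: (@circle_max_eq0 _ ((h *m W) i i + (h *m W) j j)) => c s cs.
  have [+ _] := hmax _ (rotmx_ortho ij cs) (rotmx_levi c s lij).
  rewrite [X in X <= _]mxtrace_mulC mulmxA mxtrace_mul_rotmx.
  by rewrite [X in _ <= X]mxtrace_mulC; lra.
have e2 : (W *m h) j i - (W *m h) i j = 0.
  apply: (@circle_max_eq0 _ ((W *m h) i i + (W *m h) j j)) => c s cs.
  have [_] := hmax _ (rotmx_ortho ij cs) (rotmx_levi c s lij).
  by rewrite mxtrace_mul_rotmx; lra.
move: e1 e2; rewrite !WhE !hWE => e1 e2.
(* Eliminating [h j i] from the two symmetry relations. *)
have : h i j * ((i.+1%:R : R) ^+ 2 - j.+1%:R ^+ 2) = 0.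
  transitivity (j.+1%:R * (h j i * i.+1%:R - h i j * j.+1%:R)
    - i.+1%:R * (j.+1%:R * h j i - i.+1%:R * h i j)); first by ring.
  by rewrite e1 e2 !mulr0 subrr.
move=> /eqP; rewrite mulf_eq0 subr_eq0 => /orP[/eqP //|].
rewrite eqrXn2 ?ler0n // eqr_nat eqSS => /eqP /val_inj ji.
by rewrite ji eqxx in ij.
Qed.

(** Both factors range over the compact group of orthogonal matrices in [levi lam], and a maximum of
    the trace of [W k1 g k2] is diagonal by the first-order conditions. Maximising inside [levi lam]
    yields factors that respect the blocks, with no separate treatment of each block. *)
Lemma exists_diagonalizer (R : realType) (n : nat) (lam : 'rV[R]_n)
    (g : 'M[R]_n) : levi lam g ->
  exists k1 k2 : 'M[R]_n, [/\ orthogonalmx k1, orthogonalmx k2, levi lam k1,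
    levi lam k2 & forall i j, i != j -> (k1 *m g *m k2) i j = 0].
Proof.
move=> gl; pose W := diag_mx (\row_(i < n) (i.+1%:R : R)).
pose E := [set x | exists k1 k2 : 'M[R]_n, [/\ orthogonalmx k1, orthogonalmx k2,
  levi lam k1, levi lam k2 & x = \tr (W *m (k1 *m g *m k2))]].
have supE : has_sup E.
  split.
    exists (\tr (W *m (1%:M *m g *m 1%:M))), 1%:M, 1%:M.
    by split=> //; [exact: orthogonalmx1 | exact: orthogonalmx1 | exact: levi1 | exact: levi1].
  exists (\sum_(i < n) i.+1%:R * \sum_j \sum_k `|g k j|).
  move=> _ [k1 [k2 [k1o k2o _ _ ->]]]; apply: ler_sum => i _.
  rewrite mul_diag_mx !mxE ler_wpM2l // (le_trans (ler_norm _)) //.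
  rewrite (le_trans (ler_norm_sum _ _ _)) // ler_sum // => j _.
  rewrite normrM mxE (le_trans (ler_wpM2l _ (orthogonalmx_entry j i k2o))) // mulr1.
  rewrite (le_trans (ler_norm_sum _ _ _)) // ler_sum // => k _.
  by rewrite normrM ler_piMl // orthogonalmx_entry.
have [F [e [FU eE eF]]] := ultra_sup supE.
have [k1 k1P] := choice eE.
have [k2 k2P] := choice k1P.
have orthoF (k : nat -> 'M[R]_n) : (forall i, orthogonalmx (k i)) ->
    exists l : 'M[R]_n, k @ F --> l.
  move=> ko; apply: (@ultra_bounded_cvg_mx _ _ _ _ _ _ _ 1).
  by apply: filterE => t i j; exact: orthogonalmx_entry.
have [l1 kl1] : exists l : 'M[R]_n, k1 @ F --> l.
  by apply: orthoF => i; have [] := k2P i.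
have [l2 kl2] : exists l : 'M[R]_n, k2 @ F --> l.
  by apply: orthoF => i; have [] := k2P i.
have l1o : orthogonalmx l1 by apply: orthogonalmx_cvg kl1; apply: filterE => i; have [] := k2P i.
have l2o : orthogonalmx l2 by apply: orthogonalmx_cvg kl2; apply: filterE => i; have [] := k2P i.
have l1l : levi lam l1 by apply: levi_cvg kl1; apply: filterE => i; have [] := k2P i.
have l2l : levi lam l2 by apply: levi_cvg kl2; apply: filterE => i; have [] := k2P i.
have EM : sup E = \tr (W *m (l1 *m g *m l2)).
  apply: (cvg_unique (@Rhausdorff R) eF).
  apply: (cvg_near_eq (f := fun i => \tr (W *m (k1 i *m g *m k2 i)))).
    by apply: filterE => i; have [_ _ _ _ ->] := k2P i.
  have /cvg_mxP h : W *m (k1 i *m g *m k2 i) @[i --> F] --> W *m (l1 *m g *m l2).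
    apply: cvg_mulmx; first exact: cvg_cst.
    by apply: cvg_mulmx => //; apply: cvg_mulmx => //; exact: cvg_cst.
  by apply: cvg_sum_seq => i; exact: h.
have Emax (a b : 'M[R]_n) : orthogonalmx a -> orthogonalmx b -> levi lam a -> levi lam b ->
    \tr (W *m (a *m g *m b)) <= \tr (W *m (l1 *m g *m l2)).
  move=> ao bo al bl; rewrite -EM; apply: ub_le_sup; first by case: supE.
  by exists a, b.
exists l1, l2; split => //.
apply: (@maximizer_diagonal _ _ lam).
  by apply: leviM => //; exact: leviM.
move=> k ko kl; split.
  have := Emax (k *m l1) l2 (orthogonalmxM ko l1o) l2o (leviM kl l1l) l2l.
  by rewrite !mulmxA.
have := Emax l1 (l2 *m k) l1o (orthogonalmxM l2o ko) l1l (leviM l2l kl).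
by rewrite !mulmxA.
Qed.

(** The signs of the diagonal form go into the left orthogonal factor and the absolute values become
    exponentials. As [g] has determinant 1, the two orthogonal factors have equal determinants, and
    the case -1 is repaired by inserting a reflection on both sides. *)
Lemma levi_KAK (R : realType) (n : nat) (lam : 'rV[R]_n.+1)
    (g : 'M[R]_n.+1) : SL g -> levi lam g ->
  exists (k1 k2 : 'M[R]_n.+1) (eta : 'rV[R]_n.+1), [/\ orthogonalmx k1 /\ SL k1, orthogonalmx k2 /\ SL k2,
    levi lam k1 /\ levi lam k2, \sum_i eta 0 i = 0 &
    g = k1 *m expmx eta *m k2].
Proof.
move=> gS gl; have [l1 [l2 [l1o l2o l1l l2l hdiag]]] := exists_diagonalizer gl.
set h := l1 *m g *m l2 in hdiag.
have gE : g = l1^T *m h *m l2^T.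
  by rewrite /h !mulmxA l1o mul1mx -mulmxA (orthogonalmx_mulr l2o) mulmx1.
have deth : \det h != 0.
  rewrite /h !det_mulmx; move: gS; rewrite /SL /= => ->; rewrite mulr1 mulf_neq0 //.
    by case/orP: (orthogonalmx_det l1o) => /eqP ->; rewrite ?oppr_eq0 oner_eq0.
  by case/orP: (orthogonalmx_det l2o) => /eqP ->; rewrite ?oppr_eq0 oner_eq0.
clearbody h.
pose d := \row_i h i i; pose E := diag_mx (\row_i Num.sg (h i i)).
have hd : h = diag_mx d.
  apply/matrixP => i j; rewrite !mxE; have [->|ij] := eqVneq i j; first by [].
  by rewrite hdiag.
have h0 i : h i i != 0.
  move: deth; rewrite hd det_diag => /prodf_neq0/(_ i isT).
  by rewrite mxE -hd.
pose eta := \row_i ln `|h i i|.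
have hE : h = E *m expmx eta.
  rewrite mulmx_diag {1}hd; congr diag_mx; apply/rowP => i; rewrite !mxE.
  by rewrite lnK ?posrE ?normr_gt0 // -numEsg.
have Eo : orthogonalmx E.
  rewrite /orthogonalmx /= tr_diag_mx mulmx_diag -diag_const_mx.
  by congr diag_mx; apply/rowP => i; rewrite !mxE -expr2 sqr_sg h0.
have k1o : orthogonalmx (l1^T *m E) by apply: orthogonalmxM => //; exact: orthogonalmxT.
have k2o : orthogonalmx l2^T by exact: orthogonalmxT.
have k1l : levi lam (l1^T *m E) by apply: leviM; [exact: leviT | exact: levi_diag].
have k2l : levi lam l2^T by exact: leviT.
have {}gE : g = l1^T *m E *m expmx eta *m l2^T by rewrite gE hE !mulmxA.
move: (l1^T *m E) (l2^T) k1o k2o k1l k2l gE => k1 k2 k1o k2o k1l k2l gE.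
have detgE : \det k1 * expR (\sum_i eta 0 i) * \det k2 = 1.
  by move: gS; rewrite /SL /= gE !det_mulmx det_expmx.
have expP := expR_gt0 (\sum_i eta 0 i).
have sum0 (x : R) : expR x = 1 -> x = 0.
  by rewrite -[X in _ = X]expR0 => /expR_inj.
have dets : \sum_i eta 0 i = 0 /\
    (\det k1 = 1 /\ \det k2 = 1 \/ \det k1 = -1 /\ \det k2 = -1).
  move: detgE expP; case/orP: (orthogonalmx_det k1o) => /eqP ->;
    case/orP: (orthogonalmx_det k2o) => /eqP ->;
    rewrite ?mulNr ?mulrN ?opprK !mulr1 ?mul1r.
  - by move=> /sum0 -> _; split=> //; left.
  - by move=> eE; rewrite -oppr_lt0 eE ltNge ler01.
  - by move=> eE; rewrite -oppr_lt0 eE ltNge ler01.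
  - by move=> /sum0 -> _; split=> //; right.
case: dets => eta0 [[d1 d2]|[d1 d2]]; first by exists k1, k2, eta.
(* Being diagonal, this reflection lies in [levi lam] and commutes with [expmx eta], so it can be
   inserted twice. *)
pose E0 : 'M[R]_n.+1 := diag_mx (\row_i (if i == 0 then -1 else 1)).
have E0E0 : E0 *m E0 = 1%:M.
  rewrite mulmx_diag -diag_const_mx.
  by congr diag_mx; apply/rowP => i; rewrite !mxE; case: eqP => _; ring.
have E0o : orthogonalmx E0 by rewrite /orthogonalmx /= tr_diag_mx.
have detE0 : \det E0 = -1.
  rewrite det_diag (bigD1 0) //= big1 => [|i i0]; last by rewrite mxE (negPf i0).
  by rewrite mxE eqxx mulr1.
exists (k1 *m E0), (E0 *m k2), eta; split.
- by split; [exact: orthogonalmxM | rewrite /SL /= det_mulmx d1 detE0 mulrNN mulr1].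
- by split; [exact: orthogonalmxM | rewrite /SL /= det_mulmx d2 detE0 mulrNN mulr1].
- by split; apply: leviM => //; exact: levi_diag.
- by [].
have AE : E0 *m expmx eta = expmx eta *m E0.
  by rewrite !mulmx_diag; congr diag_mx; apply/rowP => i; rewrite !mxE mulrC.
by rewrite gE !mulmxA -(mulmxA k1 E0) AE !mulmxA -(mulmxA _ E0 E0) E0E0 mulmx1.
Qed.

(** * Iwasawa decomposition and exterior powers *)

Definition upper_pos (R : realType) (n : nat) : set 'M[R]_n :=
  [set b | (forall i j : 'I_n, (j < i)%N -> b i j = 0) /\ forall i, 0 < b i i].

Definition posdef (R : realType) (n : nat) : set 'M[R]_n :=
  [set S : 'M[R]_n | S^T = S /\
    forall x : 'cV[R]_n, x != 0 -> 0 < (x^T *m S *m x) 0 0].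

Lemma posdef_schur (R : realType) (n : nat) (s : 'M[R]_1) (r : 'rV[R]_n)
    (S : 'M[R]_n) : posdef (block_mx s r r^T S : 'M[R]_(1 + n)) ->
  0 < s 0 0 /\ posdef (S - (s 0 0)^-1 *: (r^T *m r)).
Proof.
case; rewrite tr_block_mx => /eq_block_mx[_ _ _ ST] pos.
have s0 : 0 < s 0 0.
  have /pos : col_mx (1%:M : 'M[R]_1) (0 : 'cV[R]_n) != 0.
    by rewrite col_mx_eq0 negb_and oner_eq0.
  rewrite tr_col_mx mul_row_block mul_row_col !trmx0 trmx1 !mul1mx !mul0mx.
  by rewrite !mulmx0 !addr0 mulmx1.
split=> //; split.
  by rewrite linearB /= linearZ /= ST trmx_mul trmxK.
(* Completing the square: [z] is the first coordinate that minimises the form for given [y], and the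
   minimum is the form of the Schur complement at [y]. *)
move=> y y0; pose z := (- (s 0 0)^-1) *: (r *m y).
have /pos : col_mx z y != 0 by rewrite col_mx_eq0 negb_and y0 orbT.
rewrite tr_col_mx mul_row_block mul_row_col.
suff -> : (z^T *m s + y^T *m r^T) *m z + (z^T *m r + y^T *m S) *m y =
    y^T *m (S - (s 0 0)^-1 *: (r^T *m r)) *m y by [].
have -> : z^T *m s + y^T *m r^T = 0.
  rewrite /z linearZ /= trmx_mul -scalemxAl {2}(mx11_scalar s) mul_mx_scalar.
  by rewrite scalerA mulNr mulVf ?gt_eqF // scaleN1r addNr.
rewrite mul0mx add0r mulmxBr; congr (_ *m _); rewrite addrC; congr (_ + _).
by rewrite /z linearZ /= trmx_mul -scalemxAl scaleNr -scalemxAr mulmxA.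
Qed.

(** Induction on the size: the first row of [b] is that of [S] divided by the square root of the
    pivot, and the rest comes from the Schur complement. *)
Lemma cholesky (R : realType) (n : nat) (S : 'M[R]_n) : posdef S ->
  exists b : 'M[R]_n, upper_pos b /\ S = b^T *m b.
Proof.
elim: n S => [|n IH] S Sp.
  exists 0; split; last by apply/matrixP => -[].
  by split; case.
pose S' : 'M[R]_(1 + n) := S.
have SE : S' = block_mx (ulsubmx S') (ursubmx S') (ursubmx S')^T (drsubmx S').
  rewrite trmx_ursub /S'; case: Sp => -> _; exact: esym (submxK _).
have /posdef_schur : posdef (block_mx (ulsubmx S') (ursubmx S') (ursubmx S')^T (drsubmx S') : 'M[R]_(1 + n)).
  by rewrite -SE.
move: (ulsubmx S') (ursubmx S') (drsubmx S') SE => s r D SE [s0 /IH[b [[bu bp] bE]]].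
have q0 : 0 < Num.sqrt (s 0 0) by rewrite sqrtr_gt0.
set q := Num.sqrt (s 0 0) in q0 *.
have qq : q * q = s 0 0 by rewrite -expr2 sqr_sqrtr // ltW.
pose b1 : 'M[R]_(1 + n) := block_mx (q%:M : 'M[R]_1) (q^-1 *: r) 0 b.
exists b1; split; last first.
  change (S' = b1^T *m b1); rewrite SE tr_block_mx mulmx_block !trmx0.
  rewrite !mul0mx !mulmx0 !addr0 tr_scalar_mx -!scalar_mxM qq -mx11_scalar.
  rewrite mul_scalar_mx scalerA divff ?gt_eqF //.
  rewrite scale1r linearZ /= mul_mx_scalar scalerA mulfV ?gt_eqF // scale1r.
  rewrite -bE -scalemxAl -scalemxAr scalerA -invfM qq.
  by rewrite addrC subrK.
rewrite /b1; split=> [i j|i].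
  case: (@split_ordP 1 n i) => i' ->; case: (@split_ordP 1 n j) => j' -> /=.
  - by rewrite !ord1.
  - by rewrite !ord1.
  - by move=> _; rewrite (@block_mxEdl R 1 n 1 n) mxE.
  - by rewrite (@block_mxEdr R 1 n 1 n) ltn_add2l; exact: bu.
case: (@split_ordP 1 n i) => i' ->.
  by rewrite (@block_mxEul R 1 n 1 n) !ord1 mxE eqxx mulr1n.
by rewrite (@block_mxEdr R 1 n 1 n).
Qed.

Lemma det_mxsub_perm (R : realType) (n : nat) (s : 'S_n) (b : 'M[R]_n) :
  \det (mxsub s s b) = \det b.
Proof.
have -> : mxsub s s b = row_perm s (col_perm s b).
  by apply/matrixP => i j; rewrite !mxE.
rewrite row_permE col_permE !det_mulmx !det_perm odd_permV mulrC -mulrA.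
by rewrite -signr_addb addbb expr0 mulr1.
Qed.

Lemma det_upper (R : realType) (n : nat) (b : 'M[R]_n) :
  (forall i j : 'I_n, (j < i)%N -> b i j = 0) -> \det b = \prod_i b i i.
Proof.
move=> bu; rewrite -det_tr det_trig; first by apply: eq_bigr => i _; rewrite mxE.
by apply/is_trig_mxP => i j ij; rewrite mxE bu.
Qed.

Lemma posdef_gram (R : realType) (n : nat) (h : 'M[R]_n) :
  h \in unitmx -> posdef (h^T *m h).
Proof.
move=> hu; split=> [|x x0]; first by rewrite trmx_mul trmxK.
have : h *m x != 0 by apply: contra x0 => /eqP hx; rewrite -(mulKmx hu x) hx mulmx0.
rewrite mulmxA -mulmxA -trmx_mul; move: (h *m x) => {x0}x x0.
rewrite mxE; have [i xi] : exists i, x i 0 != 0.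
  apply/existsP; apply: contraT => /existsPn x00; case/eqP: x0.
  by apply/colP => i; rewrite [RHS]mxE; apply/eqP; move: (x00 i); rewrite negbK.
rewrite (bigD1 i) //= ltr_pwDl //.
  by rewrite mxE -expr2 lt_neqAle sqr_ge0 eq_sym sqrf_eq0 xi.
by apply: sumr_ge0 => j _; rewrite mxE -expr2 sqr_ge0.
Qed.

(** Cholesky for the Gram matrix of [g] reindexed by [s] gives [p] with [g^T g = p^T p], so [g p^-1]
    is orthogonal. The permutation makes [p] triangular for the order s(0), s(1), ... of the basis,
    later the order of the entries of [lam]. *)
Lemma iwasawa (R : realType) (n : nat) (g : 'M[R]_n) (s : 'S_n) : SL g ->
  exists k b : 'M[R]_n, [/\ orthogonalmx k, SL k, upper_pos b, \prod_i b i i = 1 &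
    g = k *m mxsub s^-1%g s^-1%g b].
Proof.
move=> gS.
have gu : g \in unitmx by rewrite unitmxE; move: gS; rewrite /SL /= => ->; rewrite unitr1.
have hE : mxsub s s (g^T *m g) = (col_perm s g)^T *m col_perm s g.
  by apply/matrixP => i j; rewrite !mxE; apply: eq_bigr => l _; rewrite !mxE.
have [|b [bu bE]] := @cholesky R n (mxsub s s (g^T *m g)).
  rewrite hE; apply: posdef_gram.
  by rewrite col_permE unitmx_mul gu unitmx_perm.
pose p := mxsub s^-1%g s^-1%g b.
have detp : \det p = \prod_i b i i by rewrite det_mxsub_perm det_upper //; case: bu.
have detp0 : 0 < \det p by rewrite detp; apply: prodr_gt0 => i _; case: bu.
have pu : p \in unitmx by rewrite unitmxE unitfE gt_eqF.
have pE : g^T *m g = p^T *m p.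
  apply/matrixP => i j.
  have := congr1 (fun M : 'M[R]_n => M (s^-1%g i) (s^-1%g j)) bE.
  rewrite !mxE !permKV => ->.
  rewrite (reindex_inj (@perm_inj _ s^-1%g)) /=; apply: eq_bigr => l _.
  by rewrite !mxE.
have ko : orthogonalmx (g *m invmx p).
  rewrite /orthogonalmx /= trmx_mul mulmxA -(mulmxA _ g^T) pE mulmxA -mulmxA mulmxV //.
  by rewrite mulmx1 -trmx_mul mulmxV // trmx1.
have gE : g = g *m invmx p *m p by rewrite mulmxKV.
have kS : \det (g *m invmx p) = 1.
  have : \det g = \det (g *m invmx p) * \det p by rewrite -det_mulmx -gE.
  move: gS; rewrite {1}/SL /= => ->.
  case/orP: (orthogonalmx_det ko) => /eqP -> // h.
  by have := @ltr01 R; rewrite h mulN1r oppr_gt0 ltNge ltW.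
exists (g *m invmx p), b; split => //.
by move: gS; rewrite {1}/SL /= {1}gE det_mulmx kS mul1r detp.
Qed.

(** Cauchy-Binet for [Y^T Y]: the squared Euclidean norm of a decomposable multivector is its Gram
    determinant. *)
Lemma wedge_gram (R : realType) (k n : nat) (v : k.-tuple 'cV[R]_n)
    (Y := \matrix_(i, j) tnth v j i 0) :
  \sum_a (wedge v a 0) ^+ 2 = \det (Y^T *m Y).
Proof.
rewrite cauchy_binet [RHS]big_enum_val /=; apply: eq_bigr => a _.
rewrite mxE expr2 -{1}det_tr; congr (_ * _); congr determinant.
  by apply/matrixP => i j; rewrite !mxE.
by apply/matrixP => i j; rewrite !mxE.
Qed.

(** The orthogonal factor does not change Gram matrices, and the triangular factor maps the span of
    the first [k] vectors, in the order [s], into itself. Only the leading block of [b]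
    contributes. *)
Lemma wedge_flag_norm (R : realType) (k n : nat) (kn : (k <= n)%N)
    (g q b : 'M[R]_n) (s : 'S_n) :
  orthogonalmx q -> upper_pos b -> g = q *m mxsub s^-1%g s^-1%g b ->
  \sum_a (wedge [tuple col (s (widen_ord kn i)) g | i < k] a 0) ^+ 2 =
  \prod_(i < k) b (widen_ord kn i) (widen_ord kn i) ^+ 2.
Proof.
move=> qo [bu _] gE; rewrite wedge_gram.
pose w := widen_ord kn; pose B := mxsub w w b.
have -> : \prod_(i < k) b (w i) (w i) ^+ 2 = \det (B^T *m B).
  rewrite det_mulmx det_tr -expr2 det_upper; last by move=> i j ij; rewrite mxE bu.
  by rewrite -prodrXl; apply: eq_bigr => i _; rewrite mxE.
congr (\det _); apply/matrixP => i j.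
transitivity ((g^T *m g) (s (w i)) (s (w j))).
  by rewrite !mxE; apply: eq_bigr => l _; rewrite !mxE !tnth_mktuple !mxE.
rewrite gE trmx_mul mulmxA -(mulmxA _ q^T) qo mulmx1 !mxE.
rewrite (reindex_inj (@perm_inj _ s)) /=.
(* Rows of index at least [k] vanish in the first [k] columns of [b]. *)
rewrite (bigID (fun l : 'I_n => (l < k)%N)) /= [X in _ + X]big1 ?addr0; last first.
  move=> l; rewrite -leqNgt => kl; rewrite !mxE !permK bu ?mul0r //.
  exact: leq_trans (ltn_ord i) kl.
rewrite (big_ord_narrow kn); apply: eq_bigr => l _.
by rewrite !mxE !permK.
Qed.

(** * Weights of a rational representation *)

Definition dotv (R : realType) (n : nat) (u v : 'rV[R]_n) : R :=
  \sum_i u 0 i * v 0 i.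

Section Dot.
Variables (R : realType) (n : nat).
Implicit Types (u v w : 'rV[R]_n) (c : R).

Lemma dotvC u v : dotv u v = dotv v u.
Proof. by apply: eq_bigr => i _; rewrite mulrC. Qed.

Lemma dotvDr u v w : dotv u (v + w) = dotv u v + dotv u w.
Proof. by rewrite -big_split /=; apply: eq_bigr => i _; rewrite mxE mulrDr. Qed.

Lemma dotvZr c u v : dotv u (c *: v) = c * dotv u v.
Proof. by rewrite mulr_sumr; apply: eq_bigr => i _; rewrite mxE mulrCA. Qed.

Lemma dotvDl u v w : dotv (v + w) u = dotv v u + dotv w u.
Proof. by rewrite dotvC dotvDr !(dotvC u). Qed.

Lemma dotvZl c u v : dotv (c *: v) u = c * dotv v u.
Proof. by rewrite dotvC dotvZr (dotvC u). Qed.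

Lemma dotvBl u v w : dotv (v - w) u = dotv v u - dotv w u.
Proof. by rewrite dotvDl -scaleN1r dotvZl mulN1r. Qed.

Lemma dotvv_ge0 u : 0 <= dotv u u.
Proof. by apply: sumr_ge0 => i _; rewrite -expr2 sqr_ge0. Qed.

Lemma sqr_le_dotvv u i : u 0 i ^+ 2 <= dotv u u.
Proof.
rewrite /dotv (bigD1 i) //= -expr2 lerDl.
by apply: sumr_ge0 => j _; rewrite -expr2 sqr_ge0.
Qed.

Lemma dotvv_eq0 u : (dotv u u == 0) = (u == 0).
Proof.
apply/eqP/eqP => [u0|->]; last by apply: big1 => i _; rewrite mxE mul0r.
apply/rowP => i; rewrite mxE; apply/eqP; rewrite -sqrf_eq0 eq_le sqr_ge0 andbT.
by rewrite -u0 sqr_le_dotvv.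
Qed.

Lemma sumvD u v : \sum_i (u + v) 0 i = \sum_i u 0 i + \sum_i v 0 i.
Proof. by rewrite -big_split /=; apply: eq_bigr => i _; rewrite mxE. Qed.

Lemma sumvZ c u : \sum_i (c *: u) 0 i = c * \sum_i u 0 i.
Proof. by rewrite mulr_sumr; apply: eq_bigr => i _; rewrite mxE. Qed.

Lemma sumvZD c u v : \sum_i u 0 i = 0 -> \sum_i v 0 i = 0 ->
  \sum_i (c *: u + v) 0 i = 0.
Proof. by move=> u0 v0; rewrite sumvD sumvZ u0 v0 mulr0 addr0. Qed.

Lemma exists_notin (s : seq R) : exists x, x \notin s.
Proof.
suff [x sx] : exists x, {in s, forall y, y < x}.
  by exists x; apply/negP => /sx; rewrite ltxx.
elim: s => [|y s [x sx]]; first by exists 0.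
exists (Num.max x (y + 1)) => z; rewrite inE => /predU1P[->|/sx zx].
  by rewrite lt_max ltrDl ltr01 orbT.
by rewrite lt_max zx.
Qed.

(** Each new [d] is handled by adding a multiple of [d] itself: this keeps the sum zero, and only
    finitely many multiples are bad. *)
Lemma generic_vector (ds : seq 'rV[R]_n) :
  (forall d : 'rV[R]_n, d \in ds -> d != 0 /\ \sum_i d 0 i = 0) ->
  exists eta : 'rV[R]_n, \sum_i eta 0 i = 0 /\ (forall d, d \in ds -> dotv d eta != 0).
Proof.
elim: ds => [_|d ds IH dsP].
  by exists 0; split=> //; apply: big1 => i _; rewrite mxE.
have [|eta [eta0 etaP]] := IH; first by move=> e eds; apply: dsP; rewrite inE eds orbT.
have [d0 sd0] := dsP d (mem_head _ _).
(* When [dotv e d = 0] the quotient is only a harmless extra exclusion; such an [e] is not [d], and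
   its pairing with the old [eta] is unchanged. *)
have [x] := exists_notin [seq - dotv e eta / dotv e d | e <- d :: ds].
move=> /mapP xP; exists (x *: d + eta); split; first exact: sumvZD.
move=> e eds; rewrite dotvDr dotvZr.
have [ed|ed] := eqVneq (dotv e d) 0.
  rewrite ed mulr0 add0r; move: eds; rewrite inE => /predU1P[eE|/etaP //].
  by move/eqP: ed; rewrite eE dotvv_eq0 (negPf d0).
apply/negP; rewrite addr_eq0 => /eqP xE; apply: xP; exists e => //.
by rewrite -xE mulfK.
Qed.
End Dot.

Section ExpPoly.
Variables (R : realType) (n : nat).
Implicit Types (f g : 'rV[R]_n.+1 -> R).

(** Restrictions of characters to the diagonal torus of SL. Exponents are normalised to sum zero, so
    that distinct ones give distinct linear forms on the vectors [eta] of sum zero. *)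
Definition exp_sum f : Prop := exists s : seq (R * 'rV[R]_n.+1),
  (forall x, x \in s -> \sum_i x.2 0 i = 0) /\
  forall eta : 'rV[R]_n.+1, \sum_i eta 0 i = 0 ->
    f eta = \sum_(x <- s) x.1 * expR (dotv x.2 eta).

Lemma exp_sum_cst c : exp_sum (cst c).
Proof.
have sum0 : \sum_i (0 : 'rV[R]_n.+1) 0 i = 0 by apply: big1 => i _; rewrite mxE.
exists [:: (c, 0)]; split=> [x|eta _]; first by rewrite inE => /eqP ->.
by rewrite big_seq1 /dotv /= big1 ?expR0 ?mulr1 // => i _; rewrite mxE mul0r.
Qed.

Lemma exp_sumD f g : exp_sum f -> exp_sum g -> exp_sum (fun eta => f eta + g eta).
Proof.
move=> [s [s0 fE]] [t [t0 gE]]; exists (s ++ t); split=> [x|eta eta0].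
  by rewrite mem_cat => /orP[/s0|/t0].
by rewrite big_cat fE // gE.
Qed.

Lemma exp_sumM f g : exp_sum f -> exp_sum g -> exp_sum (fun eta => f eta * g eta).
Proof.
move=> [s [s0 fE]] [t [t0 gE]].
exists [seq (x.1 * y.1, x.2 + y.2) | x <- s, y <- t]; split=> [x|eta eta0].
  by move=> /allpairsP[[y z] [/= /s0 y0 /t0 z0 ->]] /=; rewrite sumvD y0 z0 addr0.
rewrite fE // gE // big_allpairs_dep /= mulr_suml; apply: eq_bigr => x _.
rewrite mulr_sumr; apply: eq_bigr => y _.
by rewrite dotvDl expRD mulrACA.
Qed.

Lemma exp_sum_expmx i j : exp_sum (fun eta => expmx eta i j).
Proof.
have [<-|ij] := eqVneq i j; last first.
  have [s [s0 sE]] := exp_sum_cst 0.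
  by exists s; split=> // eta /sE <-; rewrite mxE (negPf ij).
(* The projection of the i-th basis vector to the hyperplane of sum zero; both pair equally with
   [eta]. *)
pose w : 'rV[R]_n.+1 := \row_l ((l == i)%:R - n.+1%:R^-1).
exists [:: (1, w)]; split=> [x|eta eta0].
  rewrite inE => /eqP -> /=; under eq_bigr do rewrite mxE.
  rewrite sumrB sumr_const card_ord -[_ *+ _]mulr_natr mulVf ?pnatr_eq0 //.
  by rewrite (bigD1 i) //= eqxx big1 ?addr0 ?subrr // => l /negPf ->.
rewrite big_seq1 mul1r !mxE eqxx mulr1n; congr expR; rewrite /dotv /=.
under eq_bigr do rewrite mxE mulrBl.
rewrite sumrB -mulr_sumr eta0 mulr0 subr0 (bigD1 i) //= eqxx mul1r.
by rewrite big1 ?addr0 // => l /negPf ->; rewrite mul0r.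
Qed.

Lemma exp_sum_big (I : Type) (s : seq I) (F : I -> 'rV[R]_n.+1 -> R) :
  (forall i, exp_sum (F i)) -> exp_sum (fun eta => \sum_(i <- s) F i eta).
Proof.
move=> Fe; elim: s => [|i s IH].
  by under eq_fun do rewrite big_nil; exact: exp_sum_cst.
by under eq_fun do rewrite big_cons; exact: exp_sumD.
Qed.

Lemma exp_sum_prod (I : Type) (s : seq I) (F : I -> 'rV[R]_n.+1 -> R) :
  (forall i, exp_sum (F i)) -> exp_sum (fun eta => \prod_(i <- s) F i eta).
Proof.
move=> Fe; elim: s => [|i s IH].
  by under eq_fun do rewrite big_nil; exact: exp_sum_cst.
by under eq_fun do rewrite big_cons; exact: exp_sumM.
Qed.

Lemma exp_sumX f k : exp_sum f -> exp_sum (fun eta => f eta ^+ k).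
Proof.
move=> fe; elim: k => [|k IH].
  by under eq_fun do rewrite expr0; exact: exp_sum_cst.
by under eq_fun do rewrite exprS; exact: exp_sumM.
Qed.

Lemma exp_sum_meval (p : mpoly.mpoly (n.+1 * n.+1) R) :
  exp_sum (fun eta => mpoly.meval (mxvec (expmx eta) 0) p).
Proof.
under eq_fun do rewrite mpoly.mevalE.
apply: exp_sum_big => m; apply: exp_sumM; first exact: exp_sum_cst.
apply: exp_sum_prod => k; apply: exp_sumX.
by case/mxvec_indexP: k => i j; under eq_fun do rewrite mxvecE; exact: exp_sum_expmx.
Qed.
End ExpPoly.

(** The exponents of all entries are merged into one duplicate-free list, so the coefficients of
    each exponential form a matrix. *)
Lemma exp_sum_mx (R : realType) (n d : nat)
    (rho : 'rV[R]_n.+1 -> 'M[R]_d) : (forall i j, exp_sum (fun eta => rho eta i j)) ->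
  exists (ws : seq 'rV[R]_n.+1) (C : 'rV[R]_n.+1 -> 'M[R]_d),
  [/\ uniq ws, forall w : 'rV[R]_n.+1, w \in ws -> \sum_i w 0 i = 0 &
   forall eta : 'rV[R]_n.+1, \sum_i eta 0 i = 0 ->
     rho eta = \sum_(w <- ws) expR (dotv w eta) *: C w].
Proof.
move=> rhoe.
have [s sP] := choice (fun ij : 'I_d * 'I_d => rhoe ij.1 ij.2).
pose ws := undup (flatten [seq [seq x.2 | x <- s ij] | ij <- enum {: 'I_d * 'I_d}]).
have wsP ij x : x \in s ij -> x.2 \in ws.
  move=> xs; rewrite mem_undup; apply/flatten_mapP; exists ij; first by rewrite mem_enum.
  by apply/mapP; exists x.
exists ws, (fun w => \matrix_(i, j) \sum_(x <- s (i, j) | x.2 == w) x.1); split.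
- exact: undup_uniq.
- move=> w; rewrite mem_undup => /flatten_mapP[ij _ /mapP[x xs ->]].
  by have [/(_ x xs)] := sP ij.
move=> eta eta0; apply/matrixP => i j; have [_ /(_ _ eta0) /= ->] := sP (i, j).
rewrite summxE big_seq.
under eq_bigr => x xs.
  rewrite (_ : x.1 * _ = \sum_(w <- ws | x.2 == w) x.1 * expR (dotv w eta)); last first.
    rewrite -big_filter (perm_big [:: x.2]) /= ?big_seq1 //.
    rewrite uniq_perm ?filter_uniq ?undup_uniq // => w.
    rewrite mem_filter inE eq_sym; case: eqVneq => //= ->.
    exact: wsP xs.
  over.
rewrite -big_seq (exchange_big_dep xpredT) //=; apply: eq_bigr => w _.
by rewrite !mxE mulr_sumr; apply: eq_bigr => x _; rewrite mulrC.
Qed.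

Lemma lagrange_poly (R : fieldType) (I : eqType) (x : I -> R) (ws : seq I) :
  uniq ws -> {in ws &, injective x} -> forall w, w \in ws ->
  exists e : {poly R}, {in ws, forall w', e.[x w'] = (w' == w)%:R}.
Proof.
move=> wsu xinj w wws; pose p := \prod_(y <- rem w ws) ('X - (x y)%:P).
have p0 : p.[x w] != 0.
  rewrite horner_prod prodf_seq_neq0; apply/allP => y /=.
  rewrite mem_rem_uniq // => /andP[yw yws]; rewrite hornerXsubC subr_eq0.
  by apply: contra yw => /eqP /xinj -> //; rewrite inE.
exists ((p.[x w])^-1 *: p) => y yws; rewrite hornerZ.
have [->|yw] := eqVneq y w; first by rewrite mulVf.
rewrite (_ : p.[x y] = 0) ?mulr0 //; apply/eqP; rewrite horner_prod prodf_seq_eq0.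
apply/hasP; exists y; last by rewrite /= hornerXsubC subrr.
by rewrite mem_rem_uniq // inE yw.
Qed.

(* [C w] is the projection onto the weight space of [w]: the Lagrange
   polynomial of [w] evaluated at [rho (expmx eta0)], for a generic [eta0]. *)
Lemma weight_decomposition (R : realType) (n d : nat)
    (rho : 'M[R]_n.+1 -> 'M[R]_d) : rational_repr rho ->
  exists (ws : seq 'rV[R]_n.+1) (C : 'rV[R]_n.+1 -> 'M[R]_d),
  \sum_(w <- ws) C w = 1%:M /\
  forall w (eta : 'rV[R]_n.+1), w \in ws -> \sum_i eta 0 i = 0 ->
    C w *m rho (expmx eta) = expR (dotv w eta) *: C w.
Proof.
move=> [rho1 rhoM rhop].
have [|ws [C [wsu ws0 rhoE]]] := @exp_sum_mx R n d (fun eta => rho (expmx eta)).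
  move=> i j; have [p pE] := rhop i j.
  have [s [s0 sE]] := exp_sum_meval p.
  by exists s; split=> // eta eta0; rewrite pE ?sE //; exact: SL_expmx.
(* Avoiding the orthogonals of all differences of distinct weights makes the numbers [x w] distinct,
   as interpolation requires. *)
have [|eta0 [eta00 gen]] := @generic_vector R n.+1
    [seq x.1 - x.2 | x <- allpairs pair ws ws & x.1 != x.2].
  move=> e /mapP[[u v] + ->].
  rewrite mem_filter => /andP[/= uv /allpairsP[[u' v'] [/= uw vw [uE vE]]]].
  by rewrite subr_eq0 uv -scaleN1r addrC sumvZD ?ws0 ?uE ?vE.
pose x w := expR (dotv w eta0).
have xinj : {in ws &, injective x}.
  move=> u v uw vw /expR_inj uv; apply/eqP; apply: contraT => uv'.
  have /gen : u - v \in [seq x.1 - x.2 | x <- allpairs pair ws ws & x.1 != x.2].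
    apply/mapP; exists (u, v) => //; rewrite mem_filter /= uv'.
    by apply/allpairsP; exists (u, v).
  by rewrite dotvBl uv subrr eqxx.
have lag w : exists e : {poly R}, w \in ws ->
    {in ws, forall w', e.[x w'] = (w' == w)%:R}.
  have [/(lagrange_poly wsu xinj)[e eP]|_] := boolP (w \in ws); last by exists 0.
  by exists e.
have [e eP] := choice lag.
(* [rho (expmx (i%:R *: eta0))] stands for the i-th power of [rho (expmx eta0)]; the extra factor
   [rho (expmx eta)] carries the identity to be proved. *)
have rhoX (i : nat) (eta : 'rV[R]_n.+1) : \sum_i eta 0 i = 0 ->
    rho (expmx (i%:R *: eta0)) *m rho (expmx eta) =
    \sum_(w <- ws) (x w ^+ i * expR (dotv w eta)) *: C w.
  move=> eta_0; have i0 : \sum_j (i%:R *: eta0) 0 j = 0 by rewrite sumvZ eta00 mulr0.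
  rewrite -rhoM; [|exact: SL_expmx|exact: SL_expmx].
  rewrite -expmxD rhoE ?sumvD ?i0 ?eta_0 ?addr0 //.
  apply: eq_bigr => w _; congr (_ *: _).
  by rewrite dotvDr expRD dotvZr expRM_natl.
have CE w (eta : 'rV[R]_n.+1) : w \in ws -> \sum_i eta 0 i = 0 ->
    (\sum_(i < size (e w)) (e w)`_i *: rho (expmx (i%:R *: eta0))) *m rho (expmx eta)
    = expR (dotv w eta) *: C w.
  move=> ww eta_0; rewrite mulmx_suml.
  under eq_bigr do rewrite -scalemxAl rhoX // scaler_sumr.
  rewrite exchange_big /= (bigD1_seq w) //= [X in _ + X]big1_seq ?addr0.
    under eq_bigr do rewrite scalerA mulrA.
    by rewrite -scaler_suml -mulr_suml -horner_coef eP // eqxx mul1r.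
  move=> w' /andP[w'w w'ws]; under eq_bigr do rewrite scalerA mulrA.
  by rewrite -scaler_suml -mulr_suml -horner_coef eP // (negPf w'w) mul0r scale0r.
have sum0 : \sum_i (0 : 'rV[R]_n.+1) 0 i = 0 by apply: big1 => i _; rewrite mxE.
have dot0 (w : 'rV[R]_n.+1) : dotv w 0 = 0 by apply: big1 => i _; rewrite mxE mulr0.
exists ws, C; split.
  rewrite -rho1 -expmx0 rhoE //; apply: eq_bigr => w _.
  by rewrite dot0 expR0 scale1r.
(* At [eta = 0], [CE] identifies the Lagrange combination with [C w]; substituting this back gives
   the claim for every [eta]. *)
move=> w eta ww eta_0; have := CE w 0 ww sum0.
by rewrite expmx0 rho1 mulmx1 dot0 expR0 scale1r => {1}<-; exact: CE.
Qed.

(** [rho] is known to be polynomial only on SL, so the limit is first shown to lie in SL, which is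
    closed. *)
Lemma cvg_repr (R : realType) (n d : nat) (rho : 'M[R]_n -> 'M[R]_d)
    (T : Type) (F : set_system T) {FF : ProperFilter F} (f : T -> 'M[R]_n)
    (g : 'M[R]_n) :
  rational_repr rho -> (\forall t \near F, SL (f t)) -> f @ F --> g ->
  SL g /\ rho (f t) @[t --> F] --> rho g.
Proof.
move=> [_ _ rhop] fS fg.
have gS : SL g.
  apply: (cvg_unique (@Rhausdorff R) (cvg_det fg)).
  by apply: (cvg_near_eq (f := cst 1)); [apply: filterS fS => t -> | exact: cvg_cst].
split=> //; apply/cvg_mxP => i j; have [p pE] := rhop i j; rewrite pE //.
apply: (cvg_near_eq (f := fun t => mpoly.meval (mxvec (f t) 0) p)).
  by apply: filterS fS => t /pE ->.
under eq_fun do rewrite mpoly.mevalE; rewrite mpoly.mevalE.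
apply: cvg_sum_seq => m; apply: cvgM; first exact: cvg_cst.
apply: cvg_prod_seq => k; case/mxvec_indexP: k => a b.
under eq_fun do rewrite mxvecE; rewrite mxvecE.
move/cvg_mxP/(_ a b): fg => fg.
have fgX q : f t a b ^+ q @[t --> F] --> g a b ^+ q.
  elim: q => [|q IH]; first by under eq_fun do rewrite expr0; exact: cvg_cst.
  by under eq_fun do rewrite exprS; rewrite exprS; exact: cvgM.
exact: fgX.
Qed.

(** * Block triangular matrices *)

Lemma cvg_sum_mx (R : realType) (T I : Type) (F : set_system T) {FF : Filter F}
    (m n : nat) (s : seq I) (P : pred I) (f : I -> T -> 'M[R]_(m, n))
    (l : I -> 'M[R]_(m, n)) :
  (forall i, P i -> f i @ F --> l i) ->
  \sum_(i <- s | P i) f i t @[t --> F] --> \sum_(i <- s | P i) l i.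
Proof.
move=> fl; apply/cvg_mxP => a b; rewrite summxE big_mkcond /=.
under eq_fun do rewrite summxE big_mkcond /=.
apply: cvg_sum_seq => i; case: ifPn => [/fl /cvg_mxP //|_]; exact: cvg_cst.
Qed.

Lemma cvg_expR0 (R : realType) (a : R) : a < 0 ->
  expR (s * a) @[s --> +oo] --> 0.
Proof.
move=> a0; have : s * - a @[s --> +oo] --> +oo.
  by apply: gt0_cvgMly; [rewrite oppr_gt0 | exact: cvg_id].
move=> /cvg_comp-/(_ _ _ _ (@cvgr_expR R)).
by apply: cvg_trans; apply: near_eq_cvg; apply: filterE => s /=; rewrite mulrN opprK.
Qed.

(** If [a] is positive, multiplying by the decaying exponential of [- s a] recovers [y] as a limit
    equal to 0. Applied to single weight components, this reads information off a one-parameter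
    limit. *)
Lemma expR_scale_limit (R : realType) (m n : nat) (a : R) (y z : 'M[R]_(m, n)) :
  expR (s * a) *: y @[s --> +oo] --> z ->
  [/\ a = 0 -> y = z, 0 < a -> y = 0 & a != 0 -> z = 0].
Proof.
move=> yz.
have pos : 0 < a -> y = 0.
  move=> a0; have na0 : - a < 0 by rewrite oppr_lt0.
  rewrite -(scale0r z); apply: (cvg_mx_unique _ (cvg_scalemx (cvg_expR0 na0) yz)).
  apply: (cvg_mx_near_eq (f := cst y)); last exact: cvg_cst.
  by apply: filterE => s; rewrite scalerA -expRD mulrN addNr expR0 scale1r.
split=> [a0||a0].
- apply: (cvg_mx_unique _ yz); apply: (cvg_mx_near_eq (f := cst y)); last exact: cvg_cst.
  by apply: filterE => s; rewrite a0 mulr0 expR0 scale1r.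
- exact: pos.
rewrite -(scale0r y); apply: (cvg_mx_unique yz).
move: a0; rewrite neq_lt => /orP[a0|/pos ->].
  by apply: cvg_scalemx; [exact: cvg_expR0 | exact: cvg_cst].
by under eq_fun do rewrite scaler0; rewrite scaler0; exact: cvg_cst.
Qed.

Lemma seq_small (R : realType) (I : eqType) (s : seq I) (P : I -> R -> Prop) :
  (forall i, i \in s -> exists2 e, 0 < e & forall x, 0 < x <= e -> P i x) ->
  exists2 e, 0 < e & forall i, i \in s -> forall x, 0 < x <= e -> P i x.
Proof.
elim: s => [_|i s IH sP]; first by exists 1.
have [|e e0 eP] := IH; first by move=> j js; apply: sP; rewrite inE js orbT.
have [f f0 fP] := sP i (mem_head _ _).
exists (Num.min e f); first by rewrite lt_min e0.
move=> j + x /andP[x0]; rewrite le_min inE => /predU1P[->|js] /andP[xe xf].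
  by apply: fP; rewrite x0.
by apply: eP => //; rewrite x0.
Qed.

Lemma sorting_perm (R : realType) (n : nat) (l : 'I_n -> R) :
  exists s : 'S_n, forall i j : 'I_n, (i <= j)%N -> l (s i) <= l (s j).
Proof.
pose r := relpre l <=%R.
have rtr : transitive r by move=> x y z; exact: le_trans.
have /tuple_permP[s sE] : perm_eq (sort r (ord_tuple n)) (ord_tuple n).
  by rewrite perm_sort.
exists s => i j ij.
have rs : sorted r (sort r (ord_tuple n)) by apply: sort_sorted => x y; exact: le_total.
have := sorted_leq_nth rtr (fun x => lexx (l x)) i rs.
move=> /(_ i j); rewrite !inE size_sort size_tuple !ltn_ord => /(_ isT isT ij).
have nthE (k : 'I_n) : nth i (sort r (ord_tuple n)) k = s k.
  by rewrite sE -tnth_nth tnth_mktuple tnth_ord_tuple.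
by rewrite /r /= !nthE.
Qed.

(** Summation by parts: with partial sums [A_k] of [a], the left side is [l_m A_(m+1)] minus the sum
    of the [(l_(k+1) - l_k) A_(k+1)] for [k < m], where the increments are nonnegative and these
    [A_(k+1)] are at least [c]. *)
Lemma abel_bound (R : realType) (l a : nat -> R) (c : R) (m : nat) :
  (forall k, (k < m)%N -> l k <= l k.+1) ->
  (forall k, (0 < k <= m)%N -> c <= \sum_(i < k) a i) ->
  \sum_(i < m.+1) l i * a i <= c * (l 0%N - l m) + l m * \sum_(i < m.+1) a i.
Proof.
elim: m => [_ _|m IH lm am]; first by rewrite !big_ord1 subrr mulr0 add0r.
rewrite big_ord_recr /= [X in _ + _ * X]big_ord_recr /=.
have {}IH : \sum_(i < m.+1) l i * a i <=
    c * (l 0%N - l m) + l m * \sum_(i < m.+1) a i.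
  apply: IH => k km; first by apply: lm; rewrite ltnS ltnW.
  by case/andP: km => k0 km; apply: am; rewrite k0 ltnW.
have := lm m (ltnSn _); have := am m.+1 (leqnn _).
by move: (\sum_(i < m.+1) l i * a i) (\sum_(i < m.+1) a i) IH => x y; nra.
Qed.

Section Blocks.
Variables (R : realType) (n : nat) (lam : 'rV[R]_n) (c : R).
Let Q : 'M[R]_n := diag_mx (\row_i (lam 0 i == c)%:R).

(** For [g] in [levi lam] this is the block of [g] for the value [c], padded by the identity: its
    determinant is that of the block, and the size stays [n]. *)
Definition blockmx (g : 'M[R]_n) : 'M[R]_n := g *m Q + (1%:M - Q).

Lemma blockmxE g i j : blockmx g i j = if lam 0 j == c then g i j else (i == j)%:R.
Proof.
rewrite /blockmx mul_mx_diag !mxE; case: (eqVneq i j) => [->|ij]; case: eqP => _ /=;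
by rewrite ?mulr1 ?mulr0 ?mulr1n ?mulr0n ?subrr ?subr0 ?addr0 ?add0r.
Qed.

Lemma levi_comm g : levi lam g -> Q *m g = g *m Q.
Proof.
move=> gl; apply/matrixP => i j; rewrite mul_mx_diag mul_diag_mx !mxE.
have [->|ij] := eqVneq (lam 0 i) (lam 0 j); first by rewrite mulrC.
by rewrite gl // mulr0 mul0r.
Qed.

Lemma blockmxM g h : levi lam h -> blockmx (g *m h) = blockmx g *m blockmx h.
Proof.
move=> hl; have QQ : Q *m Q = Q.
  rewrite mulmx_diag; congr diag_mx; apply/rowP => i; rewrite !mxE.
  by case: eqP; rewrite ?mulr1 ?mulr0.
have QC : Q *m (1%:M - Q) = 0 by rewrite mulmxBr mulmx1 QQ subrr.
have CQ : (1%:M - Q) *m Q = 0 by rewrite mulmxBl mul1mx QQ subrr.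
have CC : (1%:M - Q) *m (1%:M - Q) = 1%:M - Q.
  by rewrite mulmxBr mulmx1 CQ subr0.
rewrite /blockmx; move: (1%:M - Q) QC CQ CC => N QC CQ CC.
rewrite mulmxDl !mulmxDr CC -(mulmxA g Q) -(mulmxA g Q) QC mulmx0 addr0.
rewrite -(levi_comm hl) !mulmxA CQ mul0mx add0r.
by rewrite -(mulmxA g Q Q) QQ -(mulmxA g h) -(levi_comm hl) mulmxA.
Qed.

Lemma det_blockmx_ortho k : orthogonalmx k -> levi lam k ->
  `|\det (blockmx k)| = 1.
Proof.
move=> ko kl; have : \det (blockmx k^T *m blockmx k) = 1.
  by rewrite -blockmxM // ko /blockmx mul1mx addrC subrK det1.
have -> : blockmx k^T = (blockmx k)^T.
  apply/matrixP => i j; rewrite [RHS]mxE !blockmxE mxE [j == i]eq_sym.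
  have [->//|ij] := eqVneq (lam 0 i) (lam 0 j).
  rewrite kl 1?eq_sym //; case: (eqVneq i j) ij => [->|_ _]; first by rewrite eqxx.
  by rewrite !if_same.
rewrite det_mulmx det_tr => /eqP; rewrite -expr2 sqrf_eq1.
by case/orP => /eqP ->; rewrite ?normrN normr1.
Qed.
End Blocks.

Definition levi_part (R : realType) (n : nat) (lam : 'rV[R]_n) (p : 'M[R]_n) :
    'M[R]_n :=
  \matrix_(i, j) (if lam 0 i == lam 0 j then p i j else 0).

Lemma levi_partP (R : realType) (n : nat) (lam : 'rV[R]_n) (p : 'M[R]_n) :
  levi lam (levi_part lam p).
Proof. by move=> i j ij; rewrite mxE (negPf ij). Qed.

Section LeviUpper.
Variables (R : realType) (n : nat) (lam : 'rV[R]_n) (s : 'S_n) (b : 'M[R]_n).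
Hypothesis bu : upper_pos b.
Let p := mxsub s^-1%g s^-1%g b.
Let pii i : p (s i) (s i) = b i i. Proof. by rewrite mxE permK. Qed.

Lemma det_levi_part : \det (levi_part lam p) = \prod_i b i i.
Proof.
rewrite -(det_mxsub_perm s) det_upper => [|i j ij].
  by apply: eq_bigr => i _; rewrite !mxE eqxx permK.
by rewrite !mxE !permK; case: bu => -> //; rewrite if_same.
Qed.

Lemma det_block_levi_part c : \det (blockmx lam c (levi_part lam p)) =
  \prod_(i | lam 0 i == c) p i i.
Proof.
rewrite -(det_mxsub_perm s) det_upper => [|i j ij].
  rewrite [RHS]big_mkcond [RHS](reindex_inj (@perm_inj _ s)) /=.
  by apply: eq_bigr => i _; rewrite mxE blockmxE mxE !eqxx.
rewrite mxE blockmxE mxE (inj_eq perm_inj) -(inj_eq val_inj) /= gtn_eqF //.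
by rewrite mxE !permK; case: bu => -> //; rewrite !if_same.
Qed.

(** Orthogonal factors have block determinants 1 or -1, so in each block of [lam] the entries of
    [eta] and the [ln (p i i)] have the same sum; [lam] is constant on the block. *)
Lemma levi_sum (k1 k2 : 'M[R]_n) (eta : 'rV[R]_n) :
  orthogonalmx k1 -> orthogonalmx k2 -> levi lam k1 -> levi lam k2 ->
  levi_part lam p = k1 *m expmx eta *m k2 ->
  dotv lam eta = \sum_i lam 0 i * ln (p i i).
Proof.
move=> k1o k2o k1l k2l pE.
have p0 i : 0 < p i i by rewrite mxE; case: bu.
have blockE c : \sum_(i | lam 0 i == c) eta 0 i =
    \sum_(i | lam 0 i == c) ln (p i i).
  apply: expR_inj; rewrite !expR_sum.
  have := congr1 (fun x => `|x|) (det_block_levi_part c).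
  rewrite pE !blockmxM ?det_mulmx //; last exact: levi_diag.
  rewrite !normrM (det_blockmx_ortho c k1o) // (det_blockmx_ortho c k2o) //.
  rewrite mul1r mulr1 => detE.
  transitivity `|\prod_(i | lam 0 i == c) p i i|; last first.
    rewrite ger0_norm; last by apply: prodr_ge0 => i _; exact: ltW.
    by apply: eq_bigr => i _; rewrite lnK ?posrE.
  rewrite -detE (_ : blockmx lam c (expmx eta) =
      diag_mx (\row_i if lam 0 i == c then expR (eta 0 i) else 1)); last first.
    apply/matrixP => i j; rewrite blockmxE !mxE.
    by case: (eqVneq i j) => [->|]; rewrite ?mulr1n ?mulr0n ?if_same //; case: ifP.
  rewrite det_diag ger0_norm ?big_mkcond /=; last first.
    by apply: prodr_ge0 => i _; rewrite mxE; case: ifP => _; rewrite ?expR_ge0.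
  by apply: eq_bigr => i _; rewrite mxE.
(* Blocks are indexed by level sets of [lam], since the real values themselves do not form a finite
   type. *)
rewrite /dotv !(partition_big (fun i => [set j | lam 0 j == lam 0 i]%SET) xpredT) //=.
apply: eq_bigr => B _.
have [[i0 /eqP iB]|nB] := pselect (exists i0, [set j | lam 0 j == lam 0 i0]%SET == B); last first.
  by rewrite !big_pred0 // => i; apply/negP => iB; apply: nB; exists i.
have BE i : ([set j | lam 0 j == lam 0 i]%SET == B) = (lam 0 i == lam 0 i0).
  rewrite -iB; apply/eqP/eqP => [/setP/(_ i)|ii0].
    by rewrite !inE eqxx => /esym/eqP.
  by apply/setP => j; rewrite !inE ii0.
transitivity (lam 0 i0 * \sum_(i | lam 0 i == lam 0 i0) eta 0 i).
  by rewrite mulr_sumr; apply: eq_big => // i; rewrite BE => /eqP ->.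
rewrite blockE mulr_sumr; apply: eq_big => [i|i /eqP -> //].
by rewrite BE.
Qed.
End LeviUpper.

(** * Optimal destabilising weight vectors *)

Section Kempf.
Variables (R : realType) (n d : nat) (rho : 'M[R]_n.+1 -> 'M[R]_d).
Hypothesis rhoP : rational_repr rho.
Variables (ws : seq 'rV[R]_n.+1) (C : 'rV[R]_n.+1 -> 'M[R]_d).
Hypothesis sumC : \sum_(w <- ws) C w = 1%:M.
Hypothesis weightC : forall w (eta : 'rV[R]_n.+1),
  w \in ws -> \sum_i eta 0 i = 0 ->
  C w *m rho (expmx eta) = expR (dotv w eta) *: C w.

Let rhoM g h : SL g -> SL h -> rho (g *m h) = rho g *m rho h.
Proof. by case: rhoP => _ + _; apply. Qed.

Let rho1 : rho 1%:M = 1%:M. Proof. by case: rhoP. Qed.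

Let sum_weights (x : 'cV[R]_d) : x = \sum_(w <- ws) C w *m x.
Proof. by rewrite -mulmx_suml sumC mul1mx. Qed.

Definition leading_part (lam : 'rV[R]_n.+1) (v : 'cV[R]_d) : 'cV[R]_d :=
  \sum_(w <- ws | dotv w lam == -1) C w *m v.

(* Conjugation by [expmx (s *: lam)] contracts [p] to [levi_part lam p] as
   [s] tends to infinity. *)
Lemma leading_part_levi (lam : 'rV[R]_n.+1) (p : 'M[R]_n.+1) (v : 'cV[R]_d) :
  \sum_i lam 0 i = 0 -> SL p -> SL (levi_part lam p) ->
  (forall i j, lam 0 j < lam 0 i -> p i j = 0) ->
  (forall w, w \in ws -> C w *m v != 0 -> dotv w lam <= -1) ->
  forall w, w \in ws ->
  [/\ dotv w lam = -1 ->
        C w *m (rho p *m v) = C w *m (rho (levi_part lam p) *m leading_part lam v),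
      -1 < dotv w lam -> C w *m (rho p *m v) = 0 &
      dotv w lam != -1 ->
        C w *m (rho (levi_part lam p) *m leading_part lam v) = 0].
Proof.
move=> lam0 pS p0S ptri vlam w ww.
have slam0 s : \sum_i (s *: lam) 0 i = 0 by rewrite sumvZ lam0 mulr0.
(* The factor [expR s] shifts the exponents to [1 + dotv w lam], nonpositive on the weights of [v];
   so [f] tends to the leading part. *)
pose f s := expR s *: (rho (expmx (s *: lam)) *m v).
have fE w' s : w' \in ws ->
    C w' *m f s = expR (s * (1 + dotv w' lam)) *: (C w' *m v).
  move=> w'w; rewrite /f -scalemxAr mulmxA weightC // -scalemxAl scalerA -expRD.
  by rewrite dotvZr mulrDr mulr1.
have flim : f s @[s --> +oo] --> leading_part lam v.
  apply: (cvg_mx_near_eq (f := fun s => \sum_(w' <- ws)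
      (if w' \in ws then expR (s * (1 + dotv w' lam)) *: (C w' *m v) else 0))).
    apply: filterE => s; rewrite [RHS]sum_weights big_seq [RHS]big_seq.
    by apply: eq_bigr => w' w'w; rewrite w'w fE.
  rewrite /leading_part big_seq_cond big_mkcond /=.
  apply: cvg_sum_mx => w' _; have [w'w|_] /= := boolP (w' \in ws); last exact: cvg_cst.
  have [->|w'lam] := eqVneq (dotv w' lam) (-1).
    rewrite subrr; under eq_fun do rewrite mulr0 expR0 scale1r.
    exact: cvg_cst.
  have [->|Cv] := eqVneq (C w' *m v) 0.
    by under eq_fun do rewrite scaler0; exact: cvg_cst.
  rewrite -(scale0r (C w' *m v)); apply: cvg_scalemx; last exact: cvg_cst.
  apply: cvg_expR0; rewrite -ltrBrDl sub0r lt_neqAle w'lam /=.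
  exact: vlam.
pose P s := expmx (s *: lam) *m p *m expmx (- s *: lam).
have PS s : SL (P s).
  by apply: SLM; [apply: SLM => //; exact: SL_expmx | exact: SL_expmx].
have Plim : P s @[s --> +oo] --> levi_part lam p.
  apply/cvg_mxP => i j; rewrite mxE.
  have PE s : P s i j = expR (s * (lam 0 i - lam 0 j)) * p i j.
    rewrite /P mul_mx_diag mul_diag_mx !mxE mulrAC -expRD; congr (expR _ * _).
    by rewrite mulNr mulrBr.
  under eq_fun do rewrite PE.
  have [->|ij] := eqVneq (lam 0 i) (lam 0 j).
    rewrite subrr; under eq_fun do rewrite mulr0 expR0 mul1r.
    exact: cvg_cst.
  have [ji|ij'] := ltP (lam 0 j) (lam 0 i).
    by rewrite (ptri _ _ ji); under eq_fun do rewrite mulr0; exact: cvg_cst.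
  rewrite -(mul0r (p i j)); apply: cvgM; last exact: cvg_cst.
  by apply: cvg_expR0; rewrite subr_lt0 lt_neqAle ij.
have [_ rhoPlim] := cvg_repr rhoP (filterE _ PS) Plim.
(* In the product the two conjugating exponentials on the right cancel, so its [w] component is an
   explicit exponential times that of [rho p v]. Both factors converge, hence so does this
   multiple. *)
have PfE s : C w *m (rho (P s) *m f s) =
    expR (s * (1 + dotv w lam)) *: (C w *m (rho p *m v)).
  rewrite /f -!scalemxAr (mulmxA (rho (P s))) -rhoM //; last exact: SL_expmx.
  rewrite /P -mulmxA -expmxD -scalerDl addNr scale0r expmx0 mulmx1.
  rewrite rhoM //; last exact: SL_expmx.
  by rewrite !mulmxA weightC // -!scalemxAl scalerA -expRD dotvZr mulrDr mulr1.
have Climit : expR (s * (1 + dotv w lam)) *: (C w *m (rho p *m v)) @[s --> +oo] -->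
    C w *m (rho (levi_part lam p) *m leading_part lam v).
  under eq_fun do rewrite -PfE.
  by apply: cvg_mulmx; [exact: cvg_cst | exact: cvg_mulmx].
have [e0 e1 e2] := expR_scale_limit Climit; split=> wl.
- by apply: e0; rewrite wl subrr.
- by apply: e1; rewrite -ltrBlDl sub0r.
- by apply: e2; apply: contra wl; rewrite addrC addr_eq0.
Qed.

Lemma scale_cvg0 (T : Type) (F : set_system T) {FF : ProperFilter F}
    (m k : nat) (e : T -> R) (y : T -> 'M[R]_(m, k)) (z : 'M[R]_(m, k)) :
  e t *: y t @[t --> F] --> (0 : 'M[R]_(m, k)) -> y @ F --> z -> z != 0 ->
  e @ F --> 0.
Proof.
move=> /cvg_mxP ey /cvg_mxP yz z0.
have [i [j zij]] : exists i j, z i j != 0.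
  apply: contrapT => nz; case/eqP: z0; apply/matrixP => i j; rewrite mxE.
  by apply/eqP; apply: contrapT => /negP zij; apply: nz; exists i, j.
rewrite -(mul0r (z i j)^-1).
apply: (cvg_near_eq (f := fun t => (e t *: y t) i j * (y t i j)^-1)).
  have ynz : \forall t \near F, y t i j != 0 by exact: cvgr_neq0 (yz i j) zij.
  by apply: filterS ynz => t yt; rewrite mxE mulfK.
by apply: cvgM; [move: (ey i j); rewrite mxE | exact: cvgV].
Qed.

(** Write [g t = k1 exp(eta) k2]. Along an ultrafilter the orthogonal factors converge, and [k] is
    the limit of [k2]. Where the [w] component of [rho k x] is nonzero, [exp (r t + <w, eta>)] must
    tend to 0, so its exponent is eventually negative. [P] carries further facts to the single [t]
    that is selected. *)
Lemma contract_weights (T : Type) (F : set_system T) {FF : ProperFilter F}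
    (lam : 'rV[R]_n.+1) (g : T -> 'M[R]_n.+1) (r : T -> R) (x : 'cV[R]_d)
    (P : T -> Prop) :
  (\forall t \near F, [/\ P t, SL (g t) & levi lam (g t)]) ->
  expR (r t) *: (rho (g t) *m x) @[t --> F] --> (0 : 'cV[R]_d) ->
  exists (k : 'M[R]_n.+1) t (k1 k2 : 'M[R]_n.+1) (eta : 'rV[R]_n.+1),
  [/\ orthogonalmx k /\ SL k, levi lam k, P t,
    [/\ orthogonalmx k1, orthogonalmx k2, levi lam k1, levi lam k2 &
        g t = k1 *m expmx eta *m k2] &
    \sum_i eta 0 i = 0 /\
    forall w, w \in ws -> C w *m (rho k *m x) != 0 -> r t + dotv w eta < 0].
Proof.
move=> gP gx; have [U [UU FU]] := ultraFilterLemma FF.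
have {}gx : expR (r t) *: (rho (g t) *m x) @[t --> U] --> (0 : 'cV[R]_d).
  by apply: cvg_trans gx => A /= /FU.
have {gP FU} gP := FU _ gP.
have KAK t : exists abe : 'M[R]_n.+1 * 'M[R]_n.+1 * 'rV[R]_n.+1,
    SL (g t) -> levi lam (g t) ->
    [/\ orthogonalmx abe.1.1 /\ SL abe.1.1, orthogonalmx abe.1.2 /\ SL abe.1.2,
     levi lam abe.1.1 /\ levi lam abe.1.2, \sum_i abe.2 0 i = 0 &
     g t = abe.1.1 *m expmx abe.2 *m abe.1.2].
  have [[gS gl]|ngP] := pselect (SL (g t) /\ levi lam (g t)); last first.
    by exists (0, 0, 0) => gS gl; case: ngP.
  by have [a [b [e abe]]] := levi_KAK gS gl; exists (a, b, e).
have [K KP] := choice KAK.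
have {}KP : \forall t \near U, [/\ orthogonalmx (K t).1.1 /\ SL (K t).1.1,
    orthogonalmx (K t).1.2 /\ SL (K t).1.2,
    levi lam (K t).1.1 /\ levi lam (K t).1.2, \sum_i (K t).2 0 i = 0 &
    g t = (K t).1.1 *m expmx (K t).2 *m (K t).1.2].
  by apply: filterS gP => t [_ gS gl]; exact: KP.
have [k1 k1lim] : exists l : 'M[R]_n.+1, (K t).1.1 @[t --> U] --> l.
  apply: (@ultra_bounded_cvg_mx _ _ _ _ _ _ _ 1).
  by apply: filterS KP => t [[ko _] _ _ _ _] i j; exact: orthogonalmx_entry.
have [k2 k2lim] : exists l : 'M[R]_n.+1, (K t).1.2 @[t --> U] --> l.
  apply: (@ultra_bounded_cvg_mx _ _ _ _ _ _ _ 1).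
  by apply: filterS KP => t [_ [ko _] _ _ _] i j; exact: orthogonalmx_entry.
have k1TS : \forall t \near U, SL ((K t).1.1)^T.
  by apply: filterS KP => t [[_ kS] _ _ _ _]; exact: SLT.
have [_ k1T] := cvg_repr rhoP k1TS (cvg_trmx k1lim).
have k2S : \forall t \near U, SL (K t).1.2.
  by apply: filterS KP => t [_ [_ kS] _ _ _].
have [kS rk2] := cvg_repr rhoP k2S k2lim.
(* Applying the convergent [rho k1^T] strips off the left orthogonal factor. *)
have Ax : expR (r t) *: (rho (expmx (K t).2) *m (rho (K t).1.2 *m x))
    @[t --> U] --> (0 : 'cV[R]_d).
  rewrite -(mulmx0 _ (rho k1^T)).
  apply: (cvg_mx_near_eq _ (cvg_mulmx k1T gx)).
  apply: filterS KP => t [[ko kS1] [_ kS2] _ eta0 ->].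
  rewrite -scalemxAr; congr (_ *: _).
  have ? := SL_expmx eta0; have ? := SLT kS1.
  rewrite !rhoM //; last exact: SLM.
  by rewrite !mulmxA -[rho _^T *m rho _]rhoM // ko rho1 mul1mx.
have near_w w : w \in ws -> C w *m (rho k2 *m x) != 0 ->
    \forall t \near U, r t + dotv w (K t).2 < 0.
  move=> ww Cw.
  have e0 : expR (r t + dotv w (K t).2) @[t --> U] --> (0 : R).
    apply: (scale_cvg0 (y := fun t => C w *m (rho (K t).1.2 *m x))) Cw; last first.
      by apply: cvg_mulmx; [exact: cvg_cst | apply: cvg_mulmx => //; exact: cvg_cst].
    rewrite -(mulmx0 _ (C w)).
    apply: (cvg_mx_near_eq _ (cvg_mulmx (@cvg_cst _ (C w) _ _ _) Ax)).
    apply: filterS KP => t [_ _ _ eta0 _].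
    by rewrite -scalemxAr !mulmxA weightC // -!scalemxAl scalerA expRD.
  have elt1 : \forall t \near U, `|expR (r t + dotv w (K t).2)| < 1.
    by exact: cvgr0_norm_lt e0 _ ltr01.
  apply: filterS elt1 => t.
  by rewrite ger0_norm ?expR_ge0 // -[ltRHS]expR0 ltr_expR.
have allw : \forall t \near U, forall w, w \in ws -> C w *m (rho k2 *m x) != 0 ->
    r t + dotv w (K t).2 < 0.
  elim: (ws) near_w => [_|w s IH near_w].
    by apply: filterE => t w; rewrite in_nil.
  have h1 : \forall t \near U, C w *m (rho k2 *m x) != 0 -> r t + dotv w (K t).2 < 0.
    have [Cw0|Cw0] := eqVneq (C w *m (rho k2 *m x)) 0.
      by apply: filterE => t Cwx; case/eqP: Cwx.
    by apply: filterS (near_w w (mem_head _ _) Cw0).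
  have h2 := IH (fun w' w's => near_w w' (mem_behead (s := w :: s) w's)).
  apply: filterS (filterI h1 h2) => t [t1 t2] w'; rewrite inE => /predU1P[->|] //.
  exact: t2.
have [t [[allt [Pt _ _]] Kt]] := filter_ex (filterI (filterI allw gP) KP).
exists k2, t, (K t).1.1, (K t).1.2, (K t).2.
case: Kt => [[? ?] [? ?] [? ?] ? ?]; split=> //.
- split=> //; apply: orthogonalmx_cvg k2lim.
  by apply: filterS KP => t' [_ [ko _] _ _ _].
- by apply: levi_cvg k2lim; apply: filterS KP => t' [_ _ [_ kl] _ _].
Qed.
(** The bound -1 fixes the scale: minimising the norm of [theta] is then Kempf's optimisation of the
    ratio of the largest weight to the norm. Unlike a strict inequality, it also passes to
    limits. *)
Definition destabilizing (v : 'cV[R]_d) (k : 'M[R]_n.+1) (theta : 'rV[R]_n.+1) :=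
  [/\ orthogonalmx k, SL k, \sum_i theta 0 i = 0 &
   forall w, w \in ws -> C w *m (rho k *m v) != 0 -> dotv w theta <= -1].

(** [contract_weights] with [lam = 0], for which [levi lam] is everything, and [r = 0]; finitely
    many negative pairings are then rescaled to be at most -1. *)
Lemma exists_destabilizing (T : Type) (F : set_system T) {FF : ProperFilter F}
    (g : T -> 'M[R]_n.+1) (v : 'cV[R]_d) :
  (\forall t \near F, SL (g t)) ->
  rho (g t) *m v @[t --> F] --> (0 : 'cV[R]_d) ->
  exists k theta, destabilizing v k theta.
Proof.
move=> gS gv.
have [||k [t [_ [_ [eta [[ko kS] _ _ _ [eta0 etaP]]]]]]] :=
  @contract_weights T F FF 0 g (cst 0) v (fun=> True).
- by apply: filterS gS => t gS; split=> // i j; rewrite !mxE eqxx.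
- by under eq_fun do rewrite expR0 scale1r.
have [|e e0 eP] := @seq_small R _ ws
    (fun w x => C w *m (rho k *m v) != 0 -> dotv w eta <= - x).
  move=> w ww; have [Cw0|/(etaP _ ww)] := eqVneq (C w *m (rho k *m v)) 0.
    by exists 1 => // x _.
  rewrite add0r => we; exists (- dotv w eta); first by rewrite oppr_gt0.
  by move=> x /andP[_ xe] _; rewrite lerNr.
exists k, (e^-1 *: eta); split=> //; first by rewrite sumvZ eta0 mulr0.
move=> w ww Cw; rewrite dotvZr ler_pdivrMl // mulrN1.
by apply: eP => //; rewrite e0 lexx.
Qed.

Lemma optimal_destabilizing (v : 'cV[R]_d) :
  (exists k theta, destabilizing v k theta) ->
  exists k theta, destabilizing v k theta /\
    forall k' theta', destabilizing v k' theta' ->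
      dotv theta theta <= dotv theta' theta'.
Proof.
move=> [k0 [theta0 D0]].
pose E := [set x | exists k theta, destabilizing v k theta /\ x = - dotv theta theta].
have supE : has_sup E.
  split; first by exists (- dotv theta0 theta0), k0, theta0.
  by exists 0 => _ [k [theta [_ ->]]]; rewrite oppr_le0 dotvv_ge0.
have [F [e [FU eE eF]]] := ultra_sup supE.
have [k kP] := choice eE; have [theta tP] := choice kP.
have eB : \forall i \near F, `|sup E - e i| < 1 by exact: cvgr_dist_lt eF _ ltr01.
have [l kl] : exists l : 'M[R]_n.+1, k @ F --> l.
  apply: (@ultra_bounded_cvg_mx _ _ _ _ _ _ _ 1).
  by apply: filterE => i a b; have [[ko _ _ _] _] := tP i; exact: orthogonalmx_entry.
have [th thl] : exists th : 'rV[R]_n.+1, theta @ F --> th.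
  (* Near the supremum the squared entries are at most [1 + |sup E|], and [y^2 <= B] implies
     [y <= 1 + B]. *)
  apply: (@ultra_bounded_cvg_mx _ _ _ _ _ _ _ (1 + (1 + `|sup E|))).
  apply: filterS eB => i + a b; have [_ ->] := tP i; rewrite ord1 => eB.
  have : `|theta i 0 b| ^+ 2 <= 1 + `|sup E|.
    rewrite real_normK ?num_real // (le_trans (sqr_le_dotvv _ _)) //.
    rewrite -[dotv _ _]opprK lerNl opprD.
    move: eB; rewrite ltr_distl => /andP[_ /ltW]; have := ler_norm (- sup E).
    by rewrite normrN; lra.
  have : 0 <= `|theta i 0 b| by [].
  by move: `|theta i 0 b| `|sup E| => x y; nra.
have kS : \forall i \near F, SL (k i) by apply: filterE => i; have [[]] := tP i.
have [lS rl] := cvg_repr rhoP kS kl.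
have dotl w : dotv w (theta i) @[i --> F] --> dotv w th.
  apply: cvg_sum_seq => a; apply: cvgM; first exact: cvg_cst.
  by move/cvg_mxP: thl; exact.
exists l, th; split.
  split=> //.
  - by apply: orthogonalmx_cvg kl; apply: filterE => i; have [[]] := tP i.
  - have suml : \sum_a theta i 0 a @[i --> F] --> \sum_a th 0 a.
      by apply: cvg_sum_seq => a; move/cvg_mxP: thl; exact.
    apply: (cvg_unique (@Rhausdorff R) suml).
    apply: (cvg_near_eq (f := cst 0)); last exact: cvg_cst.
    by apply: filterE => i; have [[_ _ ->]] := tP i.
  (* The constraint is closed: a component that is nonzero in the limit is nonzero eventually along
     the sequence, where the bound already holds. *)
  - move=> w ww Cw; apply: (cvgr_to_le (dotl w)).
    have [a Ca] : exists a, (C w *m (rho l *m v)) a 0 != 0.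
      apply: contrapT => nz; case/eqP: Cw; apply/colP => a; rewrite [RHS]mxE.
      by apply/eqP; apply: contrapT => /negP Ca; apply: nz; exists a.
    have Cl : C w *m (rho (k i) *m v) @[i --> F] --> C w *m (rho l *m v).
      by apply: cvg_mulmx; [exact: cvg_cst | apply: cvg_mulmx => //; exact: cvg_cst].
    have Cnz : \forall i \near F, (C w *m (rho (k i) *m v)) a 0 != 0.
      by move/cvg_mxP/(_ a 0): Cl => Cl; exact: cvgr_neq0 Cl Ca.
    apply: filterS Cnz => i Ci; have [[_ _ _ h] _] := tP i; apply: h => //.
    by apply: contra Ci => /eqP ->; rewrite mxE.
move=> k' theta' D'.
have dd : e i @[i --> F] --> - dotv th th.
  apply: (cvg_near_eq (f := fun i => - dotv (theta i) (theta i))).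
    by apply: filterE => i; have [_ ->] := tP i.
  apply: cvgN; apply: cvg_sum_seq => a.
  by apply: cvgM; move/cvg_mxP: thl; exact.
have -> : dotv th th = - sup E.
  by rewrite -(cvg_unique (@Rhausdorff R) dd eF) opprK.
rewrite lerNl; apply: ub_le_sup; first by case: supE.
by exists k', theta'.
Qed.

(* If [zeta] is orthogonal to an optimal [lam], moving [lam] slightly towards
   [zeta] does not change its norm to first order. *)
Lemma optimal_no_improvement (v : 'cV[R]_d) (lam zeta : 'rV[R]_n.+1)
    (k : 'M[R]_n.+1) :
  (forall k' theta', destabilizing v k' theta' -> dotv lam lam <= dotv theta' theta') ->
  lam != 0 -> \sum_i lam 0 i = 0 ->
  orthogonalmx k -> SL k -> \sum_i zeta 0 i = 0 -> dotv lam zeta = 0 ->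
  (forall w, w \in ws -> C w *m (rho k *m v) != 0 ->
     dotv w lam <= -1 /\ (dotv w lam = -1 -> dotv w zeta < 0)) -> False.
Proof.
move=> opt lam0 slam ko kS szeta lz wP.
have [|de de0 deP] := @seq_small R _ ws (fun w x => C w *m (rho k *m v) != 0 ->
    dotv w lam = -1 -> dotv w zeta <= - x).
  move=> w ww; have [Cw0|/(wP _ ww)[_ wz]] := eqVneq (C w *m (rho k *m v)) 0.
    by exists 1 => // x _.
  have [wl|wl] := eqVneq (dotv w lam) (-1); last by exists 1 => // x _ _ /eqP; rewrite (negPf wl).
  exists (- dotv w zeta); first by rewrite oppr_gt0 wz.
  by move=> x /andP[_ xe] _ _; rewrite lerNr.
(* Weights at -1 improve by [x * de] through [zeta]; the others start strictly below -1, and their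
   gap absorbs a small [x]. *)
have [|e e0 eP] := @seq_small R _ ws (fun w x => C w *m (rho k *m v) != 0 ->
    dotv w lam + x * dotv w zeta <= - (1 + x * de)).
  move=> w ww; have [Cw0|Cw] := eqVneq (C w *m (rho k *m v)) 0.
    by exists 1 => // x _.
  have [wl1 _] := wP _ ww Cw.
  have [wl|wl] := eqVneq (dotv w lam) (-1).
    exists 1 => // x /andP[x0 _] _; rewrite wl opprD lerD2l -mulrN ler_pM2l //.
    by apply: deP => //; rewrite de0 lexx.
  have gap : 0 < -1 - dotv w lam by rewrite subr_gt0 lt_neqAle wl.
  have den : 0 < `|dotv w zeta| + de by rewrite ltr_wpDl.
  exists ((-1 - dotv w lam) / (`|dotv w zeta| + de)); first exact: divr_gt0.
  move=> x /andP[x0]; rewrite ler_pdivlMr // => xe _.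
  have := ler_norm (dotv w zeta).
  by move: (dotv w zeta) (dotv w lam) `|_| xe => a b c; nra.
set q := dotv lam lam in opt.
have q0 : 0 < q by rewrite lt_neqAle dotvv_ge0 eq_sym dotvv_eq0 lam0.
pose Z := dotv zeta zeta; have Z0 : 0 <= Z by exact: dotvv_ge0.
(* The norm grows by [x^2 Z], while rescaling by [1 + x * de] gains at least [2 q x de]; this [x]
   makes the first smaller. The [+ 1] keeps the denominator positive if [Z = 0]. *)
pose x := Num.min e (q * de / (Z + 1)).
have Z1 : 0 < Z + 1 by rewrite ltr_wpDl.
have x0 : 0 < x by rewrite lt_min e0 divr_gt0 // mulr_gt0.
have xe : x <= e by rewrite ge_min lexx.
have xZ : x * (Z + 1) <= q * de by rewrite -ler_pdivlMr // ge_min lexx orbT.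
pose c := 1 + x * de; have c0 : 0 < c by rewrite addr_gt0 ?mulr_gt0.
have /opt : destabilizing v k (c^-1 *: (lam + x *: zeta)).
  split=> //; first by rewrite sumvZ sumvD sumvZ slam szeta mulr0 addr0 mulr0.
  move=> w ww Cw; rewrite dotvZr dotvDr dotvZr ler_pdivrMl // mulrN1.
  by apply: eP => //; rewrite x0.
rewrite dotvZl dotvZr mulrA dotvDl !dotvDr !dotvZl !dotvZr (dotvC zeta) lz.
rewrite -/q -/Z -invfM ler_pdivlMl ?mulr_gt0 // !mulr0 addr0 add0r.
apply/negP; rewrite -ltNge /c.
have xd : 0 < x * de by rewrite mulr_gt0.
have : x * (x * Z) <= x * (q * de) by rewrite ler_pM2l // (le_trans _ xZ) // ler_pM2l // lerDl.
have : 0 < q * (x * de) by rewrite mulr_gt0.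
have : 0 < q * (x * de) * (x * de) by rewrite !mulr_gt0.
by lra.
Qed.
End Kempf.

(** * The optimal flag is contracted *)

(** Taking logarithms, the squares turn the bound on the minors into [ln delta / 2] for the partial
    sums of the [ln (b i i)], whose total is 0; [abel_bound] applies after passing to natural number
    indices. *)
Lemma log_minor_sum_le (R : realType) (n : nat) (b : 'M[R]_n.+1)
    (l : 'I_n.+1 -> R) (delta : R) :
  upper_pos b -> \prod_i b i i = 1 -> 0 < delta ->
  (forall i j : 'I_n.+1, (i <= j)%N -> l i <= l j) ->
  (forall k (kn : (k <= n.+1)%N), (0 < k <= n)%N ->
     delta <= \prod_(i < k) b (widen_ord kn i) (widen_ord kn i) ^+ 2) ->
  \sum_i l i * ln (b i i) <= ln delta / 2 * (l ord0 - l ord_max).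
Proof.
move=> [_ bp] b1 d0 lP dP.
pose L k := l (inord k); pose a k := ln (b (inord k) (inord k)).
have aE k (kn : (k <= n.+1)%N) :
    \prod_(i < k) b (widen_ord kn i) (widen_ord kn i) = expR (\sum_(i < k) a i).
  rewrite expR_sum; apply: eq_bigr => i _; rewrite lnK ?posrE //.
  by congr (b _ _); apply: val_inj; rewrite /= inordK // (leq_trans (ltn_ord i)).
have a0 : \sum_(i < n.+1) a i = 0.
  apply: expR_inj; rewrite expR0 -b1 -(aE _ (leqnn _)).
  by apply: eq_bigr => i _; congr (b _ _); apply: val_inj.
have -> : \sum_i l i * ln (b i i) = \sum_(i < n.+1) L i * a i.
  by apply: eq_bigr => i _; rewrite /L /a inord_val.
have -> : ord0 = inord 0 :> 'I_n.+1 by apply: val_inj; rewrite /= inordK.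
have -> : ord_max = inord n :> 'I_n.+1 by apply: val_inj; rewrite /= inordK.
have := @abel_bound R L a (ln delta / 2) n; rewrite a0 mulr0 addr0; apply.
  by move=> k kn; apply: lP; rewrite !inordK // ltnS // ltnW.
move=> k /andP[k0 kn].
have kn1 : (k <= n.+1)%N by exact: leqW.
have := dP k kn1; rewrite k0 kn prodrXl aE -expRM_natl => /(_ isT).
rewrite -ler_ln ?posrE ?expR_gt0 // expRK => h.
by rewrite ler_pdivrMr // mulrC.
Qed.

Lemma kempf_flag (R : realType) (n d : nat) (rho : 'M[R]_n.+1 -> 'M[R]_d)
    (T : Type) (F : set_system T) {FF : ProperFilter F} (phi : T -> 'M[R]_n.+1)
    (v : 'cV[R]_d) :
  rational_repr rho -> v != 0 -> (\forall t \near F, SL (phi t)) ->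
  rho (phi t) *m v @[t --> F] --> (0 : 'cV[R]_d) ->
  exists (k0 : 'M[R]_n.+1) (s : 'S_n.+1), orthogonalmx k0 /\
  forall delta, 0 < delta ->
    ~ (\forall t \near F, forall k (kn : (k <= n.+1)%N), (0 < k <= n)%N ->
       delta <= \sum_a (wedge
         [tuple col (s (widen_ord kn i)) (phi t *m k0^T) | i < k] a 0) ^+ 2).
Proof.
move=> rhoP vn0 phiS phiv.
have [ws [C [sumC weightC]]] := weight_decomposition rhoP.
have [rho1 rhoM _] := rhoP.
have [k0 [lam [[k0o k0S lam0 vlam] opt]]] :=
  optimal_destabilizing rhoP (exists_destabilizing rhoP weightC phiS phiv).
(* With [lam = 0] a weight of [rho k0 v] would satisfy [0 <= -1], so there would be none and [v]
   would vanish. *)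
have lamn0 : lam != 0.
  apply: contra vn0 => /eqP lamE.
  have k0v : rho k0 *m v = 0.
    rewrite -(mul1mx (rho k0 *m v)) -sumC mulmx_suml big_seq big1 // => w ww.
    apply/eqP; apply: contraT => /(vlam _ ww).
    rewrite lamE /dotv big1 => [|i _]; last by rewrite mxE mulr0.
    by rewrite lerNr oppr0 ler10.
  have k0TS := SLT k0S.
  by apply/eqP; rewrite -(mul1mx v) -rho1 -k0o rhoM // -mulmxA k0v mulmx0.
have [s sP] := sorting_perm (fun i => lam 0 i).
exists k0, s; split=> // delta delta0 near_flag.
have [U [UU FU]] := ultraFilterLemma FF.
have {}phiv : rho (phi t) *m v @[t --> U] --> (0 : 'cV[R]_d).
  by apply: cvg_trans phiv => A /= /FU.
have {}phiS := FU _ phiS; have {FU} near_flag := FU _ near_flag.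
(* [G] is [phi] in the frame where the flag of [lam] is a coordinate flag; [rho (G t)] sends [v0] to
   [rho (phi t) v]. *)
pose G t := phi t *m k0^T; pose perms (b : 'M[R]_n.+1) := mxsub s^-1%g s^-1%g b.
have iwa t : exists kb : 'M[R]_n.+1 * 'M[R]_n.+1, SL (G t) ->
    [/\ orthogonalmx kb.1, SL kb.1, upper_pos kb.2, \prod_i kb.2 i i = 1 &
     G t = kb.1 *m perms kb.2].
  have [/(iwasawa s)[a [b ab]]|nG] := pselect (SL (G t)); last by exists (0, 0).
  by exists (a, b).
have [kb kbP'] := choice iwa.
pose k t := (kb t).1; pose b t := (kb t).2; pose p t := perms (b t).
have kbP : \forall t \near U, [/\ orthogonalmx (k t), SL (k t), upper_pos (b t),
    \prod_i b t i i = 1 & G t = k t *m p t].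
  by apply: filterS phiS => t St; apply: kbP'; apply: SLM => //; exact: SLT.
pose v0 := rho k0 *m v.
have pS : \forall t \near U, SL (p t).
  apply: filterS kbP => t [_ _ bu b1 _].
  by rewrite /SL /= /p /perms det_mxsub_perm det_upper //; case: bu.
have pv0 : rho (p t) *m v0 @[t --> U] --> (0 : 'cV[R]_d).
  have [k1 k1lim] : exists l : 'M[R]_n.+1, k @ U --> l.
    apply: (@ultra_bounded_cvg_mx _ _ _ _ _ _ _ 1).
    by apply: filterS kbP => t [ko _ _ _ _] i j; exact: orthogonalmx_entry.
  have kTS : \forall t \near U, SL (k t)^T.
    by apply: filterS kbP => t [_ kS _ _ _]; exact: SLT.
  have [_ kT] := cvg_repr rhoP kTS (cvg_trmx k1lim).
  rewrite -(mulmx0 _ (rho k1^T)).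
  apply: (cvg_mx_near_eq _ (cvg_mulmx kT phiv)).
  apply: filterS (filterI (filterI kbP pS) phiS) => t [[[ko kS _ _ GE] pSt] St].
  have kTSt := SLT kS.
  rewrite /v0 !mulmxA -!rhoM //; congr (rho _ *m v).
  have -> : p t = (k t)^T *m G t by rewrite GE mulmxA ko mul1mx.
  by rewrite /G -!mulmxA k0o mulmx1.
pose q := dotv lam lam.
have q0 : 0 < q by rewrite lt_neqAle dotvv_ge0 eq_sym dotvv_eq0 lamn0.
pose r t := q^-1 * \sum_i lam 0 i * ln (p t i i).
have rB : \forall t \near U,
    r t <= q^-1 * (ln delta / 2 * (lam 0 (s ord0) - lam 0 (s ord_max))).
  apply: filterS (filterI kbP near_flag) => t [[ko _ bu b1 GE] flagt].
  rewrite ler_pM2l ?invr_gt0 // (reindex_inj (@perm_inj _ s)) /=.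
  under eq_bigr do rewrite mxE permK.
  apply: (@log_minor_sum_le R n (b t) (fun i => lam 0 (s i))) => // m mn m0n.
  by rewrite -(wedge_flag_norm mn ko bu GE); exact: flagt.
(* [r] is bounded above only, but this suffices for [expR (r t)] to have a finite limit along the
   ultrafilter. *)
have epv0 : expR (r t) *: (rho (p t) *m v0) @[t --> U] --> (0 : 'cV[R]_d).
  have [l el] : exists l : R, expR (r t) @[t --> U] --> l.
    apply: (@ultra_bounded_cvg _ _ _ _ _ (expR (q^-1 * (ln delta / 2 *
      (lam 0 (s ord0) - lam 0 (s ord_max)))))).
    by apply: filterS rB => t rt; rewrite ger0_norm ?expR_ge0 // ler_expR.
  by rewrite -(scaler0 _ l); exact: cvg_scalemx.
have ptri t : upper_pos (b t) -> forall i j, lam 0 j < lam 0 i -> p t i j = 0.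
  move=> [bu _] i j ji; rewrite mxE; apply: bu; rewrite ltnNge.
  by apply/negP => /sP; rewrite !permKV leNgt ji.
pose x := leading_part ws C lam v0.
have P0S : \forall t \near U, SL (levi_part lam (p t)).
  by apply: filterS kbP => t [_ _ bu b1 _]; rewrite /SL /= det_levi_part.
(* On weights pairing to -1 with [lam], the components of [rho p0 x] and [rho p v0] agree; all other
   components of [rho p0 x] vanish. *)
have ex : expR (r t) *: (rho (levi_part lam (p t)) *m x) @[t --> U] -->
    (0 : 'cV[R]_d).
  have -> : (0 : 'cV[R]_d) = \sum_(w <- ws | dotv w lam == -1) C w *m (0 : 'cV[R]_d).
    by rewrite big1 // => w _; rewrite mulmx0.
  apply: (cvg_mx_near_eq (f := fun t => \sum_(w <- ws | dotv w lam == -1)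
      C w *m (expR (r t) *: (rho (p t) *m v0)))); last first.
    by apply: cvg_sum_mx => w _; apply: cvg_mulmx => //; exact: cvg_cst.
  apply: filterS (filterI (filterI kbP pS) P0S) => t [[[_ _ bu _ _] pSt] P0St].
  rewrite -[RHS]mul1mx -sumC mulmx_suml big_seq_cond big_mkcond [RHS]big_seq [RHS]big_mkcond.
  apply: eq_bigr => w _ /=; have [ww|//] /= := boolP (w \in ws).
  have [e1 _ e3] := leading_part_levi rhoP sumC weightC lam0 pSt P0St (ptri t bu) vlam ww.
  rewrite -!scalemxAr; case: eqP => [/e1 ->|/eqP/e3 ->] //.
  by rewrite scaler0.
have [|kap [t [k1 [k2 [eta [[kapo kapS] kapl bu [k1o k2o k1l k2l PE] [eta0 etaP]]]]]]] :=
  @contract_weights _ _ _ _ rhoP ws C weightC _ U _ lam _ r x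
    (fun t => upper_pos (b t)) _ ex.
  apply: filterS (filterI kbP P0S) => t [[_ _ bu _ _] St].
  by split=> //; exact: levi_partP.
have lamE : dotv lam eta = q * r t.
  by rewrite (levi_sum bu k1o k2o k1l k2l PE) /r mulrA divff ?gt_eqF // mul1r.
apply: (@optimal_no_improvement _ _ _ rho ws C v lam (eta - r t *: lam) (kap *m k0)) => //.
- exact: orthogonalmxM.
- exact: SLM.
- by rewrite addrC -scaleNr sumvZD.
- by rewrite dotvDr lamE -scaleNr dotvZr -/q mulNr mulrC subrr.
(* [kap] is its own block diagonal part, so [leading_part_levi] applies to it: [lam] still
   destabilises in the frame [kap *m k0], and the components at -1 are those of [rho kap x], to
   which [etaP] applies. *)
move=> w ww; rewrite rhoM // -mulmxA -/v0 => Cw.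
have kapE : levi_part lam kap = kap.
  by apply/matrixP => i j; rewrite mxE; case: eqP => // /eqP/kapl ->.
have kaptri i j : lam 0 j < lam 0 i -> kap i j = 0.
  by move=> ji; apply: kapl; rewrite gt_eqF.
have kapS' : SL (levi_part lam kap) by rewrite kapE.
have [e1 e2 _] := leading_part_levi rhoP sumC weightC lam0 kapS kapS' kaptri vlam ww.
have wlam : dotv w lam <= -1 by rewrite leNgt; apply/negP => /e2 /eqP; rewrite (negPf Cw).
split=> // wl; rewrite dotvDr -scaleNr dotvZr wl mulrN1 opprK addrC.
by apply: etaP => //; rewrite -/x -{1}kapE -e1.
Qed.

(** * Definable functions *)

Section OMinimal.
Variables (R : realType) (S : omin_structure R).

Lemma definableI m (A B : set 'rV[R]_m) :
  definable S A -> definable S B -> definable S (A `&` B).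
Proof.
move=> dA dB; rewrite -[A `&` B]setCK setCI; apply: definableC.
by apply: definableU; exact: definableC.
Qed.

Lemma definable_forall m (I : finType) (P : I -> set 'rV[R]_m) :
  (forall i, definable S (P i)) -> definable S [set z | forall i, P i z].
Proof.
move=> dP; suff h (s : seq I) : definable S [set z | forall i, i \in s -> P i z].
  rewrite (_ : [set z | _] = [set z | forall i, i \in enum I -> P i z]) //.
  by apply/seteqP; split=> z /= Pz i; [move=> _ | apply: Pz; rewrite mem_enum].
elim: s => [|i s IH].
  rewrite (_ : [set z | _] = setT); first exact: definableT.
  by apply/seteqP; split=> z //= _ i; rewrite in_nil.
rewrite (_ : [set z | _] = P i `&` [set z | forall i, i \in s -> P i z]).
  exact: definableI.
apply/seteqP; split=> z /= Pz.
  split=> [|j js]; first exact: Pz (mem_head _ _).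
  by apply: Pz; rewrite inE js orbT.
by move=> j; rewrite inE => /predU1P[->|]; case: Pz => // _; exact.
Qed.

(** Iterated projection. Indices are matched by value and [N] by an equation, which avoids casts
    between row lengths. *)
Lemma definable_drop d k N (e : N = (k + d)%N) (A : set 'rV[R]_N) :
  definable S A -> definable S [set x : 'rV[R]_k | exists z, A z /\
    forall (i : 'I_k) (j : 'I_N), val j = val i -> x 0 i = z 0 j].
Proof.
elim: d N e A => [|d IH] N e A dA.
  rewrite addn0 in e; move: A dA; rewrite e => A dA.
  rewrite (_ : [set x | _] = A) //; apply/seteqP; split=> x /=.
    move=> [z [Az xz]]; rewrite (_ : x = z) //; apply/rowP => i.
    exact: xz.
  by move=> Ax; exists x; split=> // i j /val_inj ->.
have {}e : N = (k + d + 1)%N by rewrite e addnS addn1.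
move: A dA; rewrite e => A dA.
have := IH _ erefl _ (definable_proj dA).
congr (definable S _); apply/seteqP; split=> x /=.
  move=> [_ [[z Az <-] xz]]; exists z; split=> // i j ji.
  have jkd : (j < k + d)%N by rewrite ji (leq_trans (ltn_ord i)) // leq_addr.
  rewrite (xz i (Ordinal jkd)) // mxE; congr (z _ _); exact: val_inj.
move=> [z [Az xz]]; exists (lsubmx z); split; first by exists z.
by move=> i j ji; rewrite mxE; apply: xz.
Qed.

Lemma definable_lift k m (A : set 'rV[R]_m) : definable S A ->
  definable S [set z : 'rV[R]_(k + m) | A (\row_j z 0 (rshift k j))].
Proof.
move=> dA; elim: k => [|k IH].
  move: dA; congr (definable S _); apply/seteqP; split=> z /=.
    rewrite (_ : \row_j z 0 (rshift 0 j) = z) //.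
    by apply/rowP => j; rewrite mxE; congr (z _ _); exact: val_inj.
  rewrite (_ : \row_j z 0 (rshift 0 j) = z) //.
  by apply/rowP => j; rewrite mxE; congr (z _ _); exact: val_inj.
have := definable_prodl IH; congr (definable S _).
apply/seteqP; split=> z /=.
  rewrite (_ : \row_j rsubmx z 0 (rshift k j) = \row_j z 0 (rshift k.+1 j)) //.
  by apply/rowP => j; rewrite !mxE; congr (z _ _); exact: val_inj.
rewrite (_ : \row_j rsubmx z 0 (rshift k j) = \row_j z 0 (rshift k.+1 j)) //.
by apply/rowP => j; rewrite !mxE; congr (z _ _); exact: val_inj.
Qed.

(** The preimage of [A] is the projection of the pairs (x, y) with [y] in [A] and [x_(s j) = y_j];
    [s] may repeat or omit coordinates. *)
Lemma definable_reindex m k (s : 'I_m -> 'I_k) (A : set 'rV[R]_m) :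
  definable S A -> definable S [set x : 'rV[R]_k | A (\row_j x 0 (s j))].
Proof.
move=> dA.
have dB := definableI (definable_lift k dA) (definable_forall
  (fun j : 'I_m => definable_diag S (lshift m (s j)) (rshift k j))).
have := definable_drop erefl dB; congr (definable S _).
apply/seteqP; split=> x /=.
  move=> [z [[Az zd] xz]]; rewrite (_ : \row_j x 0 (s j) = \row_j z 0 (rshift k j)) //.
  by apply/rowP => j; rewrite !mxE (xz _ (lshift m (s j))) // zd.
move=> Ax; exists (row_mx x (\row_j x 0 (s j))); split.
  split=> [|j]; last by rewrite row_mxEl row_mxEr mxE.
  rewrite (_ : \row_j _ = \row_j x 0 (s j)) //.
  by apply/rowP => j; rewrite mxE row_mxEr.
move=> i j ji; rewrite (_ : j = lshift m i) ?row_mxEl //; exact: val_inj.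
Qed.

Lemma definable_interval m (i : 'I_m) (I : interval R) :
  definable S [set x : 'rV[R]_m | x 0 i \in I].
Proof.
have dI : definable S [set x : 'rV[R]_1 | x 0 0 \in I].
  apply/definable_omin; exists [:: I]; apply/seteqP; split=> x /=.
    by move=> xI; exists I => //; rewrite inE.
  by move=> [J]; rewrite inE => /eqP ->.
have := definable_reindex (fun=> i) dI; congr (definable S _).
by apply/seteqP; split=> x /=; rewrite mxE.
Qed.

Lemma definable_fun_cst (c : R) : definable_fun S `[0, +oo[ (cst c).
Proof.
have := definableI (definable_interval (0 : 'I_2) `[0, +oo[)
  (definable_interval (1 : 'I_2) `[c, c]).
congr (definable S _); apply/seteqP; split=> x /= [x0 xc]; split=> //.
  by apply: le_anti; move: xc; rewrite in_itv /= andbC.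
by rewrite in_itv /= xc lexx.
Qed.

Lemma definable_fun_op (op : R -> R -> R) (f g : R -> R) :
  definable S [set x : 'rV[R]_3 | x 0 ord_max = op (x 0 0) (x 0 1)] ->
  definable_fun S `[0, +oo[ f -> definable_fun S `[0, +oo[ g ->
  definable_fun S `[0, +oo[ (fun t => op (f t) (g t)).
Proof.
move=> dop df dg.
(* Coordinates in R^4 are [t], the result, [f t], [g t]: those to keep come first, since
   [definable_drop] keeps an initial segment. *)
pose o i (lti : (i < 4)%N) : 'I_4 := Ordinal lti.
pose o0 := o 0%N isT; pose o1 := o 1%N isT; pose o2 := o 2%N isT; pose o3 := o 3%N isT.
have d1 := definable_reindex (fun j : 'I_2 => if j == 0 then o0 else o2) df.
have d2 := definable_reindex (fun j : 'I_2 => if j == 0 then o0 else o3) dg.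
have d3 := definable_reindex
  (fun j : 'I_3 => if j == 0 then o2 else if j == 1 then o3 else o1) dop.
have := @definable_drop 2 2 4 erefl _ (definableI d1 (definableI d2 d3)).
congr (definable S _); apply/seteqP; split=> x /=.
  move=> [z [[[z0 z2] [[_ z3] z1]] xz]]; move: z0 z1 z2 z3; rewrite !mxE /=.
  rewrite -(xz 0 o0 erefl) -(xz 1 o1 erefl) => x0 -> -> ->.
  by split.
move=> [x0 x1]; exists (\row_j nth 0 [:: x 0 0; x 0 1; f (x 0 0); g (x 0 0)] j).
split; first by split; [|split]; rewrite /= !mxE //=.
move=> i j ji; rewrite mxE ji; case: i ji => [[|[|//]] ilt] _ /=; congr (x _ _); exact: val_inj.
Qed.

Lemma definable_fun_sum (I : Type) (s : seq I) (f : I -> R -> R) :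
  (forall i, definable_fun S `[0, +oo[ (f i)) ->
  definable_fun S `[0, +oo[ (fun t => \sum_(i <- s) f i t).
Proof.
move=> df; elim: s => [|i s IH].
  rewrite (_ : (fun t => _) = cst 0); first exact: definable_fun_cst.
  by apply/funext => t; rewrite big_nil.
rewrite (_ : (fun t => _) = fun t => f i t + \sum_(i <- s) f i t).
  exact: (definable_fun_op (definable_add S)).
by apply/funext => t; rewrite big_cons.
Qed.

Lemma definable_fun_prod (I : Type) (s : seq I) (f : I -> R -> R) :
  (forall i, definable_fun S `[0, +oo[ (f i)) ->
  definable_fun S `[0, +oo[ (fun t => \prod_(i <- s) f i t).
Proof.
move=> df; elim: s => [|i s IH].
  rewrite (_ : (fun t => _) = cst 1); first exact: definable_fun_cst.
  by apply/funext => t; rewrite big_nil.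
rewrite (_ : (fun t => _) = fun t => f i t * \prod_(i <- s) f i t).
  exact: (definable_fun_op (definable_mul S)).
by apply/funext => t; rewrite big_cons.
Qed.

Lemma definable_fun_mul (f g : R -> R) :
  definable_fun S `[0, +oo[ f -> definable_fun S `[0, +oo[ g ->
  definable_fun S `[0, +oo[ (fun t => f t * g t).
Proof. exact: (definable_fun_op (definable_mul S)). Qed.

Lemma definable_fun_det (n : nat) (M : R -> 'M[R]_n) :
  (forall i j, definable_fun S `[0, +oo[ (fun t => M t i j)) ->
  definable_fun S `[0, +oo[ (fun t => \det (M t)).
Proof.
move=> dM; apply: definable_fun_sum => s; apply: definable_fun_mul.
  exact: definable_fun_cst.
by apply: definable_fun_prod => i; exact: dM.
Qed.

Lemma interval_eventually (I : interval R) :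
  (\forall x \near +oo, x \in I) \/ (\forall x \near +oo, x \notin I).
Proof.
case: I => l [b c|[|]].
- right; apply: filterS (nbhs_pinfty_gt (num_real c)) => x cx.
  rewrite in_itv /=; apply/negP => /andP[_]; case: b => /=.
    by rewrite ltNge (ltW cx).
  by rewrite leNgt cx.
- right; apply: filterE => x; rewrite itv_boundlr.
  by rewrite andbC; case: l => [[]|[]].
case: l => [b c|[|]].
- left; apply: filterS (nbhs_pinfty_gt (num_real c)) => x cx.
  by rewrite in_itv /= andbT; case: b => /=; rewrite ?cx ?(ltW cx).
- by left; apply: filterE => x; rewrite itv_boundlr.
- by right; apply: filterE => x; rewrite itv_boundlr.
Qed.

(** The sublevel set, projected to the [t] axis, is a finite union of intervals, and each interval
    eventually contains or misses [t]. *)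
Lemma eventual_dichotomy (f : R -> R) (delta : R) :
  definable_fun S `[0, +oo[ f ->
  (\forall t \near +oo, f t < delta) \/ (\forall t \near +oo, delta <= f t).
Proof.
move=> df.
have := @definable_drop 1 1 2 erefl _
  (definableI df (definable_interval (1 : 'I_2) `]-oo, delta[)).
move=> /definable_omin[s sE].
have fE t : 0 <= t -> f t < delta <-> exists2 I, I \in s & t \in I.
  move=> t0; have := congr1 (fun A : set 'rV[R]_1 => A (const_mx t)) sE.
  rewrite /= !mxE => <-; split=> [ft|[z [[[_ z1]]]]].
    exists (\row_j nth 0 [:: t; f t] j); rewrite !mxE /= !in_itv /= andbT t0.
    by split=> // i j ji; rewrite !mxE ji !ord1.
  by rewrite in_itv /= z1 => fz /(_ 0 0 erefl); rewrite mxE => ->.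
have [h|h] : (\forall t \near +oo, exists2 I, I \in s & t \in I) \/
    (\forall t \near +oo, ~ exists2 I, I \in s & t \in I).
  elim: (s) => [|I s' IH]; first by right; apply: filterE => t [].
  have [tI|tI] := interval_eventually I.
    by left; apply: filterS tI => t; exists I => //; rewrite inE eqxx.
  have [ts|ts] := IH.
    by left; apply: filterS ts => t [J Js tJ]; exists J => //; rewrite inE Js orbT.
  right; apply: filterS (filterI tI ts) => t [{}tI {}ts] [J].
  rewrite inE => /predU1P[->|Js tJ]; first by rewrite (negPf tI).
  by apply: ts; exists J.
- left; apply: filterS (filterI h (nbhs_pinfty_ge (num_real 0))) => t [ht t0].
  exact/fE.
- right; apply: filterS (filterI h (nbhs_pinfty_ge (num_real 0))) => t [ht t0].
  by rewrite leNgt; apply/negP => ft; apply: ht; exact/fE.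
Qed.
End OMinimal.

(** * The exterior representations *)

Lemma incr_tuple_sorted k n (a : 'I_(extdim k n)) :
  sorted ltn (map val (enum_val a : k.-tuple 'I_n)).
Proof. by have := enum_valP a; rewrite inE. Qed.

Lemma extmx1 (R : realType) (k n : nat) : extmx k (1%:M : 'M[R]_n) = 1%:M.
Proof.
apply/matrixP => a b; rewrite !mxE.
have uniqI (c : 'I_(extdim k n)) : uniq (enum_val c : k.-tuple 'I_n).
  rewrite -(map_inj_uniq val_inj).
  by apply: (sorted_uniq ltn_trans ltnn); exact: incr_tuple_sorted.
have [->|ab] := eqVneq a b.
  rewrite (_ : mxsub _ _ _ = 1%:M) ?det1 //; apply/matrixP => i j; rewrite !mxE.
  by congr (_%:R); congr nat_of_bool; apply: inj_eq; apply/tuple_uniqP.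
(* Distinct increasing tuples of equal length have distinct supports; an index of [b] outside [a]
   gives a zero column. *)
have [j jb] : exists j, tnth (enum_val b) j \notin (enum_val a : k.-tuple 'I_n).
  apply/existsP; apply: contraT => /existsPn sub; case/eqP: ab.
  apply/enum_val_inj/val_inj/(inj_map val_inj).
  apply: (irr_sorted_eq ltn_trans ltnn); try exact: incr_tuple_sorted.
  have sub' : {subset (enum_val b : k.-tuple 'I_n) <= (enum_val a : k.-tuple 'I_n)}.
    by move=> x /tnthP[j ->]; have := sub j; rewrite negbK.
  have [|_ ba] := uniq_min_size (uniqI b) sub'; first by rewrite !size_tuple.
  by apply: eq_mem_map => x; rewrite ba.
rewrite (expand_det_col _ j) big1 // => i _; rewrite !mxE.
case: eqP => [ij|_]; last by rewrite mul0r.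
by case/negP: jb; rewrite -ij mem_tnth.
Qed.

Lemma extmxM (R : realType) (k n : nat) (g h : 'M[R]_n) :
  extmx k (g *m h) = extmx k g *m extmx k h.
Proof.
apply/matrixP => a b; rewrite !mxE.
rewrite (_ : mxsub _ _ _ =
  rowsub (tnth (enum_val a)) g *m colsub (tnth (enum_val b)) h); last first.
  by apply/matrixP => i j; rewrite !mxE; apply: eq_bigr => l _; rewrite !mxE.
rewrite cauchy_binet [LHS]big_enum_val /=; apply: eq_bigr => c _; rewrite !mxE.
by congr (_ * _); congr determinant; apply/matrixP => i j; rewrite !mxE.
Qed.

Import (canonicals) mpoly.

Lemma extmx_rational (R : realType) (k n : nat) : rational_repr (@extmx R k n).
Proof.
split; [exact: extmx1 | by move=> g h _ _; exact: extmxM | move=> a b].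
(* The entry is a minor of the generic matrix, since evaluation commutes with determinants. *)
pose X : 'M[mpoly.mpoly (n * n) R]_n :=
  \matrix_(i, j) mpoly.mpolyX R (mpoly.mnm1 (mxvec_index i j)).
exists (\det (mxsub (tnth (enum_val a)) (tnth (enum_val b)) X)) => g _.
rewrite mxE -det_map_mx; congr determinant; apply/matrixP => i j.
by rewrite !mxE /= mpoly.mevalXU mxvecE.
Qed.

(** A zero norm is a singular Gram matrix [Y^T Y]; a kernel vector [u] satisfies [|Y u^T|^2 = 0],
    which is a linear relation between the vectors. *)
Lemma wedge_neq0 (R : realType) (k n : nat) (v : k.-tuple 'cV[R]_n) :
  free v -> wedge v != 0.
Proof.
move=> vf; apply/negP => /eqP w0; have := wedge_gram v.
rewrite big1 => [|a _]; last by rewrite w0 mxE expr0n.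
move=> /esym/eqP /det0P[u u0 uY].
set Y := \matrix_(i, j) _ in uY.
have Yu0 : Y *m u^T = 0.
  have : (Y *m u^T)^T *m (Y *m u^T) = 0.
    by rewrite trmx_mul trmxK !mulmxA -(mulmxA u) uY mul0mx.
  move: (Y *m u^T) => y /(congr1 (fun M : 'M[R]_1 => M 0 0)); rewrite !mxE => y0.
  apply/colP => i; rewrite mxE; apply/eqP; rewrite -sqrf_eq0 eq_le sqr_ge0 andbT.
  rewrite -y0 (bigD1 i) //= mxE -expr2 lerDl.
  by apply: sumr_ge0 => j _; rewrite mxE -expr2 sqr_ge0.
case/eqP: u0; apply/rowP => j; rewrite mxE.
move: vf => /freeP/(_ (fun l => u 0 l)) ->//.
transitivity (Y *m u^T); last exact: Yu0.
apply/colP => i; rewrite summxE mxE; apply: eq_bigr => l _.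
by rewrite !mxE mulrC (tnth_nth 0).
Qed.

Lemma free_orthonormal (R : realType) (k n : nat) (q : 'M[R]_n) (f : 'I_k -> 'I_n) :
  orthogonalmx q -> injective f ->
  free [tuple q^T *m (delta_mx (f i) 0 : 'cV[R]_n) | i < k].
Proof.
move=> qo fi; apply/freeP => c cw i.
set w := [tuple q^T *m (delta_mx (f i) 0 : 'cV[R]_n) | i < k] in cw.
transitivity ((q *m \sum_(j < k) c j *: w`_j) (f i) 0); last by rewrite cw mulmx0 mxE.
have qw (j : 'I_k) : q *m (c j *: w`_j) = c j *: delta_mx (f j) 0.
  rewrite -tnth_nth tnth_mktuple -scalemxAr mulmxA.
  by rewrite (orthogonalmx_mulr qo) mul1mx.
rewrite mulmx_sumr summxE (bigD1 i) //= big1 ?addr0 => [|j ji].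
  by rewrite qw !mxE !eqxx mulr1.
by rewrite qw !mxE (inj_eq fi) eq_sym (negPf ji) mulr0.
Qed.

Lemma cvg_sumsq0 (R : realType) (T : Type) (F : set_system T) {FF : Filter F}
    (m : nat) (y : T -> 'cV[R]_m) :
  (forall delta, 0 < delta -> \forall t \near F, \sum_a y t a 0 ^+ 2 < delta) ->
  y @ F --> (0 : 'cV[R]_m).
Proof.
move=> ysmall; apply/cvg_mxP => a j; rewrite ord1 mxE {j}.
apply/cvgr0Pnorm_lt => e e0.
have /ysmall : 0 < e ^+ 2 by rewrite exprn_gt0.
apply: filterS => t yt; rewrite -(ltr_pXn2r (n := 2)) ?nnegrE ?(ltW e0) //.
rewrite real_normK ?num_real // (le_lt_trans _ yt) // (bigD1 a) //= lerDl.
by apply: sumr_ge0 => b _; rewrite sqr_ge0.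
Qed.

(** * Flags along a definable curve *)

Section Flag.
Variables (R : realType) (S : omin_structure R) (n : nat) (phi : R -> 'M[R]_n).
Hypothesis phi_def : forall i j, definable_fun S `[0, +oo[ (fun t => phi t i j).

Lemma definable_flag_norm (k : nat) (q : 'M[R]_n) (f : 'I_k -> 'I_n) :
  definable_fun S `[0, +oo[ (fun t =>
    \sum_a (wedge [tuple col (f i) (phi t *m q) | i < k] a 0) ^+ 2).
Proof.
apply: definable_fun_sum => a.
have dw : definable_fun S `[0, +oo[
    (fun t => wedge [tuple col (f i) (phi t *m q) | i < k] a 0).
  rewrite (_ : (fun t => _) = fun t => \det (\matrix_(i, j)
      \sum_l phi t (tnth (enum_val a) i) l * q l (f j))); last first.
    apply/funext => t; rewrite mxE; congr determinant; apply/matrixP => i j.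
    by rewrite !mxE tnth_mktuple !mxE.
  apply: definable_fun_det => i j.
  rewrite (_ : (fun t => _) = fun t =>
    \sum_l phi t (tnth (enum_val a) i) l * q l (f j)); last first.
    by apply/funext => t; rewrite mxE.
  apply: definable_fun_sum => l; apply: definable_fun_mul => //.
  exact: definable_fun_cst.
by rewrite (_ : (fun t => _) = fun t => wedge [tuple col (f i) (phi t *m q) | i < k] a 0 *
  wedge [tuple col (f i) (phi t *m q) | i < k] a 0); [exact: definable_fun_mul|].
Qed.

(** The columns of [phi t *m q^T] are the images under [phi t] of the orthonormal frame formed by
    the columns of [q^T]. Without a lower bound, the dichotomy puts the squared norm eventually
    below every positive [delta], so the wedge would tend to 0. *)
Lemma flag_norm_lower_bound (q : 'M[R]_n) (k : nat) (f : 'I_k -> 'I_n) :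
  orthogonalmx q -> injective f ->
  (forall v : k.-tuple 'cV[R]_n, free v ->
     ~ (extmx k (phi t) *m wedge v @[t --> +oo] --> (0 : 'cV[R]_(extdim k n)))) ->
  exists2 delta, 0 < delta & \forall t \near +oo,
    delta <= \sum_a (wedge [tuple col (f i) (phi t *m q^T) | i < k] a 0) ^+ 2.
Proof.
move=> qo fi /(_ _ (free_orthonormal qo fi)) ncvg.
apply: contrapT => nd; apply: ncvg; apply: cvg_sumsq0 => delta delta0.
have [sm|lb] := eventual_dichotomy delta (definable_flag_norm q^T f); last first.
  by case: nd; exists delta.
apply: filterS sm => t; apply: le_lt_trans; rewrite le_eqVlt; apply/orP; left.
apply/eqP/eq_bigr => a _; rewrite extmx_wedge.
congr (wedge _ a 0 ^+ 2); apply: eq_from_tnth => i.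
by rewrite !tnth_mktuple mulmxA colE.
Qed.
End Flag.

Theorem proposition1p6 (R : realType) (S : omin_structure R) (n : nat)
    (n_gt0 : (0 < n)%N) (phi : R -> 'M[R]_n)
    (phi_SL : forall t, 0 <= t -> SL (phi t))
    (phi_cont : {within `[0, +oo[, continuous phi})
    (phi_def : forall i j, definable_fun S `[0, +oo[ (fun t => phi t i j)) :
  non_contracting phi <->
  (forall k : nat, (1 <= k <= n - 1)%N ->
   forall v : k.-tuple 'cV[R]_n, free v ->
     ~ (extmx k (phi t) *m wedge v @[t --> +oo] --> (0 : 'cV[R]_(extdim k n)))).
Proof.
split=> [nc k _ v vf | H d rho rhoP v v0 cvg0].
  exact: nc (extmx_rational R k n) _ (wedge_neq0 vf).
case: n n_gt0 phi phi_SL {phi_cont} phi_def H rho rhoP cvg0 => // n _ phi phi_SL phi_def.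
rewrite subn1 /= => H rho rhoP cvg0.
have phiS : \forall t \near +oo, SL (phi t).
  by apply: filterS (nbhs_pinfty_ge (num_real 0)) => t; exact: phi_SL.
have [k0 [s [k0o nlb]]] := kempf_flag rhoP v0 phiS cvg0.
(* [kempf_flag] asks for one [delta] valid in all degrees 1 to [n] at once: the minimum of the
   finitely many bounds, built degree by degree. *)
have lb m : (m <= n)%N -> exists2 delta, 0 < delta & \forall t \near +oo,
    forall k (kn : (k <= n.+1)%N), (0 < k <= m)%N ->
    delta <= \sum_a (wedge
         [tuple col (s (widen_ord kn i)) (phi t *m k0^T) | i < k] a 0) ^+ 2.
  elim: m => [_|m IH mn].
    by exists 1 => //; apply: filterE => t k kn; case: k kn.
  have [d1 d10 d1P] := IH (ltnW mn).
  have mn1 : (m.+1 <= n.+1)%N by exact: leqW.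
  have finj : injective (fun i : 'I_m.+1 => s (widen_ord mn1 i)).
    by move=> i j /perm_inj /(congr1 val) /= /val_inj.
  have [|d2 d20 d2P] := flag_norm_lower_bound phi_def k0o finj; first exact: H.
  exists (Num.min d1 d2); first by rewrite lt_min d10.
  apply: filterS (filterI d1P d2P) => t [t1 t2] k kn.
  rewrite [(k <= m.+1)%N]leq_eqVlt => /andP[k_gt0 /predU1P[km|km]].
    move: kn; rewrite km => kn; rewrite ge_min (bool_irrelevance kn mn1) t2.
    by rewrite orbT.
  by rewrite ge_min t1 // k_gt0.
have [delta delta0 deltaP] := lb n (leqnn n).
exact: nlb delta0 deltaP.
Qed.
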